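(* Let $d\ge 1$ and $n\ge d+3$. Then any linear automorphism $\mathbf A$ of $L_{d,n}$ is a scalar multiple of a signed permutation that is induced by a vertex relabeling.
   Context: Let $N=\binom n2$ and index the coordinates of $\mathbb C^N$ by the edges $ij$ ($1\le i<j\le n$) of the complete graph $K_n$. For a complex configuration $\mathbf p=(\mathbf p_1,\dots,\mathbf p_n)$ of points in $\mathbb C^d$ put $m_{ij}(\mathbf p)=\sum_{k=1}^d(\mathbf p_i^k-\mathbf p_j^k)^2$ (no conjugation) and $m(\mathbf p)=(m_{ij}(\mathbf p))_{ij}\in\mathbb C^N$. $M_{d,n}\subset\mathbb C^N$ is the image of $m$ over all complex configurations, $s:\mathbb C^N\to\mathbb C^N$ is the coordinate-wise squaring map, and $L_{d,n}:=s^{-1}(M_{d,n})$, the unsquared measurement variety. A linear automorphism of $L_{d,n}$ is a non-singular complex $N\times N$ matrix $\mathbf A$ with $\mathbf A(L_{d,n})=L_{d,n}$. A signed permutation is a matrix $\mathbf S\mathbf P$ with $\mathbf S$ diagonal with entries $\pm1$ and $\mathbf P$ an $N\times N$ permutation matrix; it is induced by a vertex relabeling if $\mathbf P$ is the permutation of the edges of $K_n$ induced by a permutation of the vertices $\{1,\dots,n\}$. *)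

(* Defs.v *)
From HB Require Import structures.
From mathcomp Require Import all_boot all_order all_algebra all_fingroup.
From mathcomp Require Import complex classical_sets reals.

Set Implicit Arguments.
Unset Strict Implicit.
Unset Printing Implicit Defensive.

Import GRing.Theory.

Local Open Scope ring_scope.
Local Open Scope classical_set_scope.

Definition edge (n : nat) := {e : 'I_n * 'I_n | (e.1 < e.2)%N}.

Definition nedges (n : nat) : nat := #|{: edge n}|.

Lemma nedgesE n : nedges n = 'C(n, 2).
Proof.
rewrite /nedges card_sig -sum1_card.
rewrite -(pair_big_dep xpredT (fun i j : 'I_n => i < j)%N (fun _ _ => 1%N)) /=.
rewrite (exchange_big_dep xpredT) //= -bin2_sum big_mkord.
apply: eq_bigr => j _.
by rewrite -(big_ord_widen n (fun=> 1%N)) ?sum1_card ?card_ord // ltnW.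
Qed.

(* Coordinates are numbered by 'I_(nedges n) through the enumeration of the
   edges, so that coordinate k belongs to the edge (src k, tgt k). *)
Definition src n (k : 'I_(nedges n)) : 'I_n := (val (enum_val k)).1.
Definition tgt n (k : 'I_(nedges n)) : 'I_n := (val (enum_val k)).2.
Definition ends n (k : 'I_(nedges n)) : {set 'I_n} := [set src k; tgt k]%SET.

Section Varieties.
Variables (R : realType) (d n : nat).
Implicit Types A S P : 'M[R[i]]_(nedges n).

Definition configuration := 'I_n -> 'rV[R[i]]_d.

Definition measurement (p : configuration) : 'cV[R[i]]_(nedges n) :=
  \col_e \sum_(k < d) (p (src e) 0 k - p (tgt e) 0 k) ^+ 2.

Definition measurement_variety : set 'cV[R[i]]_(nedges n) := range measurement.

Definition coord_square (l : 'cV[R[i]]_(nedges n)) : 'cV[R[i]]_(nedges n) :=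
  map_mx (fun x => x ^+ 2) l.

Definition unsquared_variety : set 'cV[R[i]]_(nedges n) :=
  coord_square @^-1` measurement_variety.

Definition linear_automorphism A : Prop :=
  A \in unitmx /\ mulmx A @` unsquared_variety = unsquared_variety.

Definition sign_mx S : Prop :=
  exists2 eps : 'rV[R[i]]_(nedges n),
    S = diag_mx eps & forall e, eps 0 e = 1 \/ eps 0 e = -1.

(* Replacing pi and sigma by their inverses, the notion does not depend on
   whether perm_mx pi or its transpose is taken as the matrix of pi. *)
Definition relabeling_mx P : Prop :=
  exists (sigma : 'S_n) (pi : 'S_(nedges n)),
    P = perm_mx pi /\ forall e, ends (pi e) = (sigma @: ends e)%SET.

End Varieties.

(* Main.v *)
Require Import Defs.
From mathcomp Require Import all_boot all_order all_algebra all_fingroup.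
From mathcomp Require Import complex classical_sets reals.
From mathcomp Require Import ring zify mpoly.

(* A star at a vertex k is a vector supported on the edges at k, with entries 1
   or -1 there.  Let f be a polynomial of degree at most 2d+2 vanishing on L_d.
   Averaging f over sign changes, its non-even parts have too low a degree not
   to vanish, so f(l) = g(l^2) with g of degree d+1 vanishing on M_d.  As M_d is
   the d-th secant of the cone M_1 of vectors q_u = ((u_i - u_j)^2), we get
   D_q D_q g = 0 for q in M_1; polarizing at u = 1_k yields f(z + ts) of degree
   at most 2 in t for every star s.  Applying this to the composites with A of
   the (d+1)-minors of the Gram matrix, these minors have degree at most 2 in
   the direction A s.  Comparing coefficients of degree 3 forces A s to be a
   multiple of a star.  Stars at the same vertex go to stars at the same vertex,
   so A induces a vertex map kappa, and e_ij, a half difference of two stars at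
   i and also of two stars at j, goes to a multiple of e_kappa(i)kappa(j).  That
   A s has entries of equal squares makes these multiples agree up to sign. *)

Set Implicit Arguments.
Unset Strict Implicit.
Unset Printing Implicit Defensive.

Import Order.TTheory GRing.Theory Num.Theory.

Local Open Scope ring_scope.

(** * Directional derivatives of multivariate polynomials *)

Lemma poly_eq0_nat (F : numDomainType) (p : {poly F}) :
  (forall k : nat, p.[k%:R] = 0) -> p = 0.
Proof.
move=> p0; apply: (@roots_geq_poly_eq0 _ _ [seq k%:R | k <- iota 0 (size p)]).
- by apply/allP => x /mapP[k _ ->]; apply/rootP.
- by rewrite map_inj_uniq ?iota_uniq //; exact: mulrIn (oner_neq0 _).
- by rewrite size_map size_iota.
Qed.

Section MpolyCalculus.
Variables (F : numClosedFieldType) (N : nat).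
Implicit Types (g h : {mpoly F[N]}) (y : 'I_N -> F) (gam : 'I_N -> {poly F}).

(** Chain rule along a polynomial curve: both sides are additive and obey the Leibniz rule in [g],
    so constants and variables suffice. *)
Lemma deriv_mmap gam g : (mmap polyC gam g)^`() =
  \sum_a (gam a)^`() * mmap polyC gam g^`M(a).
Proof.
pose P g := (mmap polyC gam g)^`() = \sum_a (gam a)^`() * mmap polyC gam g^`M(a).
have PM g1 g2 : P g1 -> P g2 -> P (g1 * g2).
  rewrite /P => P1 P2; rewrite rmorphM derivM P1 P2 mulr_suml mulr_sumr.
  rewrite -big_split; apply: eq_bigr => a _ /=.
  by rewrite mderivM rmorphD !rmorphM /=; ring.
have PC c : P c%:MP.
  by rewrite /P mmapC derivC big1 // => a _; rewrite mderivC rmorph0 mulr0.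
have PX i : P 'X_i.
  rewrite /P mmapX mmap1U (bigD1 i) //= big1 => [|a ai].
    have UU : (U_(i) - U_(i) = 0 :> 'X_{1..N})%MM.
      by apply/mnmP => b; rewrite mnmBE subnn mnm0E.
    by rewrite mderivX mnm1E eqxx scale1r UU mpolyX0 rmorph1 mulr1 addr0.
  by rewrite mderivX mnm1E eq_sym (negbTE ai) scale0r rmorph0 mulr0.
have PD g1 g2 : P g1 -> P g2 -> P (g1 + g2).
  rewrite /P => P1 P2; rewrite rmorphD derivD P1 P2 -big_split.
  by apply: eq_bigr => a _ /=; rewrite mderivD rmorphD mulrDr.
have P1 : P 1 := PC 1.
have P0 : P 0 by have := PC 0; rewrite mpolyC0.
rewrite -/(P g) (mpolyE g); apply: (big_ind P P0 PD) => m _.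
rewrite -mul_mpolyC; apply: (PM _ _ (PC _)).
rewrite mpolyXE_id; apply: (big_ind P P1 PM) => i _; elim: (m i) => [|k IH]; first by rewrite expr0.
by rewrite exprS; apply: PM.
Qed.

Definition mdir y g : {mpoly F[N]} := \sum_a y a *: g^`M(a).

Lemma mdirD y1 y2 g : mdir (fun a => y1 a + y2 a) g = mdir y1 g + mdir y2 g.
Proof. by rewrite -big_split; apply: eq_bigr => a _ /=; rewrite scalerDl. Qed.

Lemma mdirZ c y g : mdir (fun a => c * y a) g = c *: mdir y g.
Proof. by rewrite scaler_sumr; apply: eq_bigr => a _; rewrite scalerA. Qed.

Lemma mdirZr c y g : mdir y (c *: g) = c *: mdir y g.
Proof.
by rewrite scaler_sumr; apply: eq_bigr => a _; rewrite mderivZ !scalerA mulrC.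
Qed.

Lemma mdirDr y g1 g2 : mdir y (g1 + g2) = mdir y g1 + mdir y g2.
Proof.
by rewrite -big_split; apply: eq_bigr => a _ /=; rewrite mderivD scalerDr.
Qed.

Lemma mdir0 y : mdir y 0 = 0.
Proof. by rewrite /mdir big1 // => a _; rewrite mderiv0 scaler0. Qed.

Lemma eq_mdir y1 y2 g : y1 =1 y2 -> mdir y1 g = mdir y2 g.
Proof. by move=> e; apply: eq_bigr => a _; rewrite e. Qed.

Lemma mderiv_mdir y g a : (mdir y g)^`M(a) = mdir y g^`M(a).
Proof.
rewrite /mdir raddf_sum; apply: eq_bigr => b _ /=.
by rewrite mderivZ mderiv_comm.
Qed.

Lemma mdirC y1 y2 g : mdir y1 (mdir y2 g) = mdir y2 (mdir y1 g).
Proof.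
rewrite {1}/mdir; under eq_bigr => a _ do rewrite mderiv_mdir -mdirZr.
by rewrite -(big_morph _ (mdirDr y2) (mdir0 y2)).
Qed.

(** The curves met below have velocities in the span of two constant directions, so their higher
    derivatives only involve iterated [mdir]. *)
Lemma deriv_curve gam (s t : {poly F}) y1 y2 g :
    (forall a, (gam a)^`() = s * (y1 a)%:P + t * (y2 a)%:P) ->
  (mmap polyC gam g)^`() =
  s * mmap polyC gam (mdir y1 g) + t * mmap polyC gam (mdir y2 g).
Proof.
move=> dg; rewrite deriv_mmap /mdir !raddf_sum !mulr_sumr -big_split.
by apply: eq_bigr => a _ /=; rewrite dg !mmapZ; ring.
Qed.

Lemma horner_mmap gam g t :
  (mmap polyC gam g).[t] = g.@[fun a => (gam a).[t]].
Proof.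
rewrite /meval /mmap /mmap1 horner_sum; apply: eq_bigr => m _.
rewrite hornerM hornerC; congr (_ * _); rewrite horner_prod.
by apply: eq_bigr => a _; rewrite horner_exp.
Qed.

Definition degle k g := forall m, (k < mdeg m)%N -> g@_m = 0.

Lemma degle_mderiv k g a : degle k.+1 g -> degle k g^`M(a).
Proof.
by move=> gk m km; rewrite mcoeff_deriv gk ?mul0rn // mdegD mdeg1; lia.
Qed.

Lemma degle_mdir k g y : degle k.+1 g -> degle k (mdir y g).
Proof.
move=> gk m km; rewrite /mdir raddf_sum big1 // => a _ /=.
by rewrite mcoeffZ (degle_mderiv _ gk) ?mulr0.
Qed.

Lemma mderiv_eq0_const g : (forall a, g^`M(a) = 0) -> g = (g@_0)%:MP.
Proof.
move=> dg; apply/mpolyP => m; rewrite mcoeffC.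
have [->|m0] := eqVneq m 0%MM; first by rewrite mulr1.
rewrite mulr0; have /existsP[a ma] : [exists a, m a != 0%N].
  apply: contraNT m0; rewrite negb_exists => /forallP m0.
  by apply/eqP/mnmP => a; rewrite mnm0E; apply/eqP; have := m0 a; rewrite negbK.
(* A monomial [m] containing the variable [a] is seen in the derivative at [m - U_(a)], with a
   factor that is non-zero in characteristic 0. *)
have := mcoeff_deriv a (m - U_(a))%MM g; rewrite dg mcoeff0 submK; last first.
  by apply/mnm_lepP => b; rewrite mnm1E; case: eqVneq => // <-; rewrite lt0n.
by move=> /esym/eqP; rewrite mulrn_eq0 /= => /eqP.
Qed.

Lemma meval_const_eq0 g v : (forall a, g^`M(a) = 0) -> g.@[v] = 0 -> g = 0.
Proof. by move=> /mderiv_eq0_const ->; rewrite mevalC => ->; rewrite mpolyC0. Qed.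

Lemma degle0_mderiv g a : degle 0 g -> g^`M(a) = 0.
Proof.
by move=> gk; apply/mpolyP => m; rewrite mcoeff_deriv gk ?mul0rn ?mcoeff0 // mdegD mdeg1; lia.
Qed.

End MpolyCalculus.

(** * Polynomials vanishing on the measurement variety *)

Section Edges.
Variable n : nat.
Implicit Types (a b : 'I_(nedges n)) (i j k l : 'I_n).

Lemma src_lt_tgt a : (src a < tgt a)%N.
Proof. by rewrite /src /tgt; case: (enum_val a). Qed.

Lemma src_neq_tgt a : src a != tgt a.
Proof. by apply: contraTneq (src_lt_tgt a) => ->; rewrite ltnn. Qed.

Lemma edge_inj a b : src a = src b -> tgt a = tgt b -> a = b.
Proof.
move=> s t; apply: enum_val_inj; apply: val_inj; rewrite /src /tgt in s t.
by case: (val (enum_val a)) (val (enum_val b)) s t => [? ?] [? ?] /= -> ->.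
Qed.

Lemma ends_inj : injective (@ends n).
Proof.
move=> a b eab; have := src_lt_tgt a; have := src_lt_tgt b.
have : src a \in ends b by rewrite -eab set21.
have : tgt a \in ends b by rewrite -eab set22.
rewrite !inE => /orP[] /eqP ta /orP[] /eqP sa; rewrite ?ta ?sa ?ltnn //.
  by move=> /ltnW lt1 lt2; have := leq_trans lt2 lt1; rewrite ltnn.
by move=> _ _; apply: edge_inj.
Qed.

Lemma ends_src_tgt a i j : ends a = [set i; j] ->
  (src a = i /\ tgt a = j) \/ (src a = j /\ tgt a = i).
Proof.
move=> e; have := src_neq_tgt a.
have : src a \in ends a by rewrite set21.
have : tgt a \in ends a by rewrite set22.
rewrite e !inE => /orP[] /eqP ta /orP[] /eqP sa; rewrite ?ta ?sa ?eqxx //; by [left|right].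
Qed.

Lemma edge_ex i j : i != j -> exists a, ends a = [set i; j].
Proof.
wlog ij : i j / (i < j)%N => [H|_].
  rewrite neq_ltn => /orP[] ij; first by apply: H => //; rewrite neq_ltn ij.
  by rewrite finset.setUC; apply: H => //; rewrite neq_ltn ij.
exists (enum_rank (exist (fun e : 'I_n * 'I_n => (e.1 < e.2)%N) (i, j) ij : edge n)).
by rewrite /ends /src /tgt enum_rankK.
Qed.

Lemma mem_ends a i : (i \in ends a) = (i == src a) || (i == tgt a).
Proof. by rewrite !inE. Qed.

End Edges.

Section Measurements.
Variables (F : numClosedFieldType) (n : nat).
Implicit Types (g : {mpoly F[nedges n]}) (u v : 'I_n -> F).

(* Polarization of the one-dimensional measurement map. *)
Definition cutform u v (a : 'I_(nedges n)) : F :=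
  (u (src a) - u (tgt a)) * (v (src a) - v (tgt a)).

Definition ind (i j : 'I_n) : F := (i == j)%:R.

Lemma cutform_ind a b : cutform (ind (src a)) (ind (tgt a)) b = - (a == b)%:R.
Proof.
rewrite /cutform /ind; have [<-|ab] := eqVneq a b.
  have /negbTE ts := src_neq_tgt a.
  by rewrite !eqxx ts [tgt a == _]eq_sym ts subr0 sub0r mul1r.
have [sa|sa] := eqVneq (src a) (src b).
  have [ta|ta] := eqVneq (tgt a) (tgt b); first by rewrite (edge_inj sa ta) eqxx in ab.
  by rewrite -sa [tgt a == src a]eq_sym (negbTE (src_neq_tgt a)) subrr mulr0 oppr0.
have [sb|sb] := eqVneq (src a) (tgt b); last by rewrite subrr mul0r oppr0.
have /negbTE -> : tgt a != src b.
  apply: contraTneq (src_lt_tgt a) => ->.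
  by rewrite sb -leqNgt ltnW ?src_lt_tgt.
have /negbTE -> : tgt a != tgt b by rewrite -sb eq_sym src_neq_tgt.
by rewrite subrr mulr0 oppr0.
Qed.

(** The vectors [cutform u u] span all directions: polarizing at the two ends of an edge [a] gives
    minus the basis vector of [a]. *)
Lemma mderiv_eq0_cut g :
  (forall u, mdir (cutform u u) g = 0) -> forall a, g^`M(a) = 0.
Proof.
move=> g0 a; set i := ind (src a); set j := ind (tgt a).
have := g0 (fun k => i k + j k).
rewrite (@eq_mdir _ _ _ (fun b => (cutform i i b + cutform j j b) + 2 * cutform i j b)); last first.
  by move=> b; rewrite /cutform; ring.
rewrite !mdirD mdirZ !g0 !add0r.
have -> : mdir (cutform i j) g = - g^`M(a).
  rewrite /mdir (bigD1 a) //= big1 => [|b ba].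
    by rewrite cutform_ind eqxx scaleN1r addr0.
  by rewrite cutform_ind eq_sym (negbTE ba) oppr0 scale0r.
by move/eqP; rewrite scalerN oppr_eq0 scaler_eq0 pnatr_eq0 => /eqP.
Qed.

(** A configuration is given by its [r] coordinate functions, which shows [M_r] as the [r]-fold sum
    of the cone [M_1]. *)
Definition vanish r g := forall u : 'I_r -> 'I_n -> F,
  g.@[fun a => \sum_k cutform (u k) (u k) a] = 0.

Lemma vanish0 r g : vanish r g -> g.@[fun=> 0] = 0.
Proof.
move=> /(_ (fun _ _ => 0)); rewrite (meval_eq (v2 := fun=> 0)) // => a.
by rewrite big1 // => k _; rewrite /cutform subrr mul0r.
Qed.

(** Adding [t] times [cutform v v] amounts to one more coordinate function, [sqrtC t] times [v], so
    the whole line stays in the variety; natural [t] suffice. *)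
Lemma vanish_line r g (u : 'I_r -> 'I_n -> F) v : vanish r.+1 g ->
  mmap polyC (fun a => (\sum_k cutform (u k) (u k) a)%:P + 'X * (cutform v v a)%:P) g = 0.
Proof.
move=> gr; apply: poly_eq0_nat => t; rewrite horner_mmap.
rewrite -[RHS](gr (fun k => if unlift ord0 k is Some k' then u k' else
  fun i => sqrtC t%:R * v i)); apply: meval_eq => a.
rewrite !hornerE big_ord_recl unlift_none [LHS]addrC; congr (_ + _); last first.
  by apply: eq_bigr => k _; rewrite liftK.
by rewrite -[t%:R in LHS]sqrtCK /cutform /=; ring.
Qed.

(** This is the linear coefficient in [t] of the identity [vanish_line]. *)
Lemma vanish_mdir r g v : vanish r.+1 g -> vanish r (mdir (cutform v v) g).
Proof.
move=> gr u; have := congr1 (fun p => p^`().[0]) (vanish_line u v gr).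
rewrite (@deriv_curve _ _ _ 1 0 (cutform v v) (fun=> 0)) => [|a]; last first.
  by rewrite derivD derivC derivM derivX derivC; ring.
rewrite mul0r mul1r addr0 horner_mmap derivC horner0 => e; rewrite -[RHS]e.
by apply: meval_eq => a; rewrite !hornerE.
Qed.

(** Derivatives along [M_1] lower both the degree and [r]. By induction they all vanish, so [g] is
    constant, and its value at the origin is 0. *)
Lemma vanish_degle r g : vanish r g -> degle r g -> g = 0.
Proof.
elim: r g => [|r IH] g vg dg; apply: (meval_const_eq0 _ (vanish0 vg)).
  by move=> a; apply: degle0_mderiv.
apply: mderiv_eq0_cut => u; apply: IH; first exact: vanish_mdir.
exact: degle_mdir.
Qed.

Lemma vanish_mdir2_at0 r g v : vanish r.+1 g ->
  (mdir (cutform v v) (mdir (cutform v v) g)).@[fun=> 0] = 0.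
Proof.
move=> vg; have := congr1 (fun p => p^`()^`().[0]) (vanish_line (fun _ _ => 0) v vg).
rewrite (@deriv_curve _ _ _ 1 0 (cutform v v) (fun=> 0)) => [|a]; last first.
  by rewrite derivD derivC derivM derivX derivC; ring.
rewrite mul0r mul1r addr0 (@deriv_curve _ _ _ 1 0 (cutform v v) (fun=> 0)) => [|a]; last first.
  by rewrite derivD derivC derivM derivX derivC; ring.
rewrite mul0r mul1r addr0 horner_mmap !derivC horner0 => e; rewrite -[RHS]e.
apply: meval_eq => a; rewrite !hornerE big1 // => k _.
by rewrite /cutform subrr mul0r.
Qed.

(** The second derivative commutes with a further one along [M_1], which lowers [r] and the degree.
    By induction it is constant, and at the origin it vanishes because lines through 0 along [M_1]
    stay in the variety. *)
Lemma vanish_mdir2 r g v : vanish r.+1 g -> degle r.+2 g ->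
  mdir (cutform v v) (mdir (cutform v v) g) = 0.
Proof.
elim: r g => [|r IH] g vg dg;
  apply: (meval_const_eq0 _ (vanish_mdir2_at0 v vg)).
- by move=> a; apply: degle0_mderiv; apply: degle_mdir; exact: degle_mdir.
- apply: mderiv_eq0_cut => u; rewrite mdirC [X in mdir _ X]mdirC.
  by apply: IH; [apply: vanish_mdir | apply: degle_mdir].
Qed.

End Measurements.

(** * Growth of even polynomials along stars *)

Section StarCurves.
Variables (F : numClosedFieldType) (n : nat).
Implicit Types (g : {mpoly F[nedges n]}) (u v : 'I_n -> F) (i j : 'I_n).

(* The sum has one term when [i != j] and none when [i = j]. *)
Definition crd (T : nmodType) (l : 'I_(nedges n) -> T) i j : T :=
  \sum_(a | ends a == [set i; j]%SET) l a.

Lemma crdC (T : nmodType) (l : 'I_(nedges n) -> T) i j : crd l i j = crd l j i.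
Proof. by rewrite /crd finset.setUC. Qed.

Lemma crd_ends (T : nmodType) (l : 'I_(nedges n) -> T) a i j :
  ends a = [set i; j]%SET -> crd l i j = l a.
Proof.
move=> e; rewrite /crd (eq_bigl (pred1 a)) ?big_pred1_eq // => b /=.
by rewrite -e; apply/eqP/eqP => [/ends_inj|->].
Qed.

Lemma crd_src_tgt (T : nmodType) (l : 'I_(nedges n) -> T) a :
  crd l (src a) (tgt a) = l a.
Proof. exact: crd_ends. Qed.

Lemma crdii (T : nmodType) (l : 'I_(nedges n) -> T) i : crd l i i = 0.
Proof.
rewrite /crd big_pred0 // => a; apply/eqP => e.
by have := src_neq_tgt a; case: (ends_src_tgt e) => -[-> ->]; rewrite eqxx.
Qed.

(** Identifies the coordinatewise square of a star at [i] as the point of [M_1] given by the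
    indicator of [i]. *)
Lemma cutform_ind_ends i a : cutform (@ind F n i) (ind F i) a = (i \in ends a)%:R.
Proof.
rewrite /cutform /ind mem_ends; have st := src_neq_tgt a.
have [->|_] := eqVneq i (src a); first by rewrite (negbTE st) subr0 mul1r.
have [_|_] := eqVneq i (tgt a); last by rewrite subrr mul0r.
by rewrite sub0r mulrNN mul1r.
Qed.

(** Makes the mixed term [z s] in the square of a line [z + s t] a polarized form, to which
    [mdir2_polarized] applies. *)
Lemma star_cutform i (w : 'I_(nedges n) -> F) :
    (forall a, i \notin ends a -> w a = 0) ->
  cutform (@ind F n i) (fun j => - crd w i j) =1 w.
Proof.
move=> w0 a; rewrite /cutform /ind; have := w0 a; rewrite mem_ends negb_or.
have st := src_neq_tgt a.
have [->|_] := eqVneq i (src a).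
  by move=> _; rewrite (negbTE st) crdii crd_src_tgt subr0 mul1r oppr0 sub0r opprK.
have [->|_] := eqVneq i (tgt a).
  by move=> _; rewrite crdii crdC crd_src_tgt oppr0 subr0 sub0r mulN1r opprK.
by move=> /(_ isT) ->; rewrite subrr mul0r.
Qed.

Section Polarization.
Variable g : {mpoly F[nedges n]}.
Hypothesis g2 : forall v, mdir (cutform v v) (mdir (cutform v v) g) = 0.

(** Up to constants, the three expressions are the coefficients of [e], [e^2] and [e^3] in the
    hypothesis [g2] for [u + e v]. *)
Lemma mdir2_polarized u v :
  [/\ mdir (cutform u u) (mdir (cutform u v) g) = 0,
      mdir (cutform u u) (mdir (cutform v v) g) +
        2 *: mdir (cutform u v) (mdir (cutform u v) g) = 0 &
      mdir (cutform u v) (mdir (cutform v v) g) = 0].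
Proof.
set Du := mdir (cutform u u); set Dv := mdir (cutform v v).
set Dw := mdir (cutform u v).
pose c1 : {mpoly F[nedges n]} := Du (Dw g); pose c3 : {mpoly F[nedges n]} := Dw (Dv g).
pose c2 : {mpoly F[nedges n]} := Du (Dv g) + 2 *: Dw (Dw g).
have E e : (4 * e) *: c1 + (2 * e ^+ 2) *: c2 + (4 * e ^+ 3) *: c3 = 0.
  have := g2 (fun i => u i + e * v i).
  have q h : mdir (cutform (fun i => u i + e * v i) (fun i => u i + e * v i)) h =
      Du h + (2 * e) *: Dw h + e ^+ 2 *: Dv h.
    rewrite -!mdirZ -!mdirD; apply: eq_mdir => a; rewrite /cutform; ring.
  rewrite !q /Du /Dv /Dw !mdirDr !mdirZr !g2 -/Du -/Dv -/Dw.
  have wu : Dw (Du g) = c1 by rewrite /Dw mdirC.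
  have vu : Dv (Du g) = Du (Dv g) by rewrite /Dv mdirC.
  have vw : Dv (Dw g) = c3 by rewrite /Dv mdirC.
  rewrite wu vu vw -/c1 -/c3 /c2 => /mpolyP H; apply/mpolyP => m; have := H m.
  rewrite !(mcoeffD, mcoeffZ, mcoeff0) => {}H; rewrite -[RHS]H; ring.
(* The values at 1 and -1 isolate [c2]; the value at 2 then gives [c3], and [c1] remains. *)
pose f e m := 4 * e * c1@_m + 2 * e ^+ 2 * c2@_m + 4 * e ^+ 3 * c3@_m.
have {}E e m : f e m = 0 by rewrite /f -!mcoeffZ -!mcoeffD E mcoeff0.
have nz k (x y : F) : k != 0%N -> k%:R * x = y -> y = 0 -> x = 0.
  by move=> /negbTE k0 <- /eqP; rewrite mulf_eq0 pnatr_eq0 k0 => /eqP.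
have c20 m : c2@_m = 0.
  apply: (nz 4%N _ (f 1 m + f (-1) m))=> //; first by rewrite /f; ring.
  by rewrite !E addr0.
have c30 m : c3@_m = 0.
  apply: (nz 24%N _ (f 2 m - 2 * f 1 m - 1 * (f 1 m + f (-1) m)))=> //; first by rewrite /f; ring.
  by rewrite !E !mulr0 !addr0 mulr0 !subr0.
split; apply/mpolyP => m; rewrite mcoeff0; [|exact: c20|exact: c30].
apply: (nz 4%N _ (f 1 m - 2 * c2@_m - 4 * c3@_m))=> //; first by rewrite /f; ring.
by rewrite c20 c30 E !mulr0 !subr0.
Qed.

(** With [u] the indicator of [i] and [v] from [star_cutform], apply [mdir w] to the second
    polarized identity: its mixed term dies by the third identity and the cube remains. *)
Lemma mdir_star3 i w : (forall a, i \notin ends a -> w a = 0) ->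
  [/\ mdir (cutform (@ind F n i) (ind F i)) (mdir w g) = 0 &
      mdir w (mdir w (mdir w g)) = 0].
Proof.
move=> /star_cutform we; set v := fun j => _ in we.
have dw h : mdir w h = mdir (cutform (ind F i) v) h by apply: eq_mdir => a; rewrite we.
have [e1 e2 e3] := mdir2_polarized (ind F i) v.
rewrite !dw e1; split=> //.
have /(congr1 (mdir (cutform (ind F i) v))) := e2.
rewrite mdirDr mdir0 mdirC e3 mdir0 add0r mdirZr => /eqP.
by rewrite scaler_eq0 pnatr_eq0 => /eqP.
Qed.

(* Along [z + sX] with [s] a star, [g] is evaluated on the curve
   [z^2 + 2(zs)X + s^2 X^2], and the third derivative only involves the
   operators killed by [mdir_star3]. *)
Lemma size_star_curve i (z s : 'I_(nedges n) -> F) :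
    (forall a, s a ^+ 2 = (i \in ends a)%:R) ->
  (size (mmap polyC (fun a => ((z a)%:P + (s a)%:P * 'X) ^+ 2) g) <= 3)%N.
Proof.
move=> sE; pose w a := z a * s a; pose sig := cutform (@ind F n i) (ind F i).
set gam := fun a => _.
have w0 a : i \notin ends a -> w a = 0.
  move=> /negbTE ia; have := sE a; rewrite ia => /eqP; rewrite expf_eq0 /= => /eqP s0.
  by rewrite /w s0 mulr0.
have dgam a : (gam a)^`() = 2 * (w a)%:P + (2 * 'X) * (sig a)%:P.
  rewrite /sig cutform_ind_ends -sE /gam expr2 derivM derivD derivM !derivC derivX.
  by rewrite /w polyCM expr2 polyCM; ring.
have [d1 d2] := mdir_star3 w0.
have dC h1 : (mmap polyC gam h1)^`() = 2 * mmap polyC gam (mdir w h1) +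
    (2 * 'X) * mmap polyC gam (mdir sig h1).
  exact: deriv_curve.
have sw : mdir w (mdir sig g) = 0 by rewrite mdirC.
have h2 : (mmap polyC gam g)^`()^`() =
    4 * mmap polyC gam (mdir w (mdir w g)) + 2 * mmap polyC gam (mdir sig g).
  rewrite dC derivD !derivM dC dC derivX -![2]/(2%:R) !derivMn -[1]/(1%:P) derivC.
  by rewrite d1 sw g2 !rmorph0 mul0rn; ring.
have h3 : (mmap polyC gam g)^`()^`()^`() = 0.
  rewrite h2 derivD !derivM !dC -[2]/(2%:R) -[4]/(4%:R) !derivMn -[1]/(1%:P) derivC.
  by rewrite d2 sw g2 (mdirC sig w) d1 mdir0 !rmorph0 !mul0rn; ring.
apply/leq_sizeP => k k3; have := congr1 (fun p : {poly F} => p`_(k - 3)) h3.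
rewrite coef0 !coef_deriv -!mulrnA => /eqP; rewrite mulrn_eq0.
by rewrite (_ : (k - 3).+3 = k)%N; [case/orP=> [|/eqP//]; lia | lia].
Qed.

End Polarization.
End StarCurves.

(** * Even and odd parts *)

Section Parity.
Variables (F : numClosedFieldType) (N : nat).
Implicit Types (f : {mpoly F[N]}) (T : {ffun 'I_N -> bool}) (m : 'X_{1.. N}).

Definition mhalf m : 'X_{1.. N} := [multinom (m a)./2 | a < N].
Definition mparity m : {ffun 'I_N -> bool} := [ffun a => odd (m a)].

(** These are the polynomials [g_T] for which [f(z)] is the sum over [T] of [z^T g_T(z^2)]; [T]
    marks the variables of odd exponent. *)
Definition parity_part T f : {mpoly F[N]} :=
  \sum_(m <- msupp f | mparity m == T) f@_m *: 'X_[mhalf m].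

Lemma mmap_parity (S : comNzRingType) (h : {rmorphism F -> S}) (z : 'I_N -> S) f :
  mmap h z f =
  \sum_(T : {ffun 'I_N -> bool}) (\prod_a z a ^+ T a) * mmap h (fun a => z a ^+ 2) (parity_part T f).
Proof.
rewrite {1}/mmap (partition_big mparity xpredT) //=; apply: eq_bigr => T _.
rewrite /parity_part raddf_sum mulr_sumr; apply: eq_bigr => m /eqP <- /=.
rewrite mmapZ mmapX mulrCA /mmap1 -big_split; congr (_ * _).
apply: eq_bigr => a _; rewrite /= mnmE ffunE -exprM -exprD.
by rewrite mul2n odd_double_half.
Qed.

Lemma mdeg_parity m : mdeg m = ((mdeg (mhalf m)).*2 + \sum_a mparity m a)%N.
Proof.
rewrite !mdegE -mul2n big_distrr -big_split; apply: eq_bigr => a _ /=.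
by rewrite mnmE ffunE mul2n addnC odd_double_half.
Qed.

Lemma degle_parity_part f T d e : degle e f -> (forall c, (d < c)%N ->
  (e < c.*2 + \sum_a T a)%N) -> degle d (parity_part T f).
Proof.
move=> fe dT m dm; rewrite raddf_sum big1_seq // => m' /andP[/eqP mT _] /=.
rewrite mcoeffZ mcoeffX; have [mm|_] := eqVneq; last by rewrite mulr0.
by rewrite fe ?mul0r // mdeg_parity mT mm dT.
Qed.

(** Orthogonality of the characters of the sign group: summing the hypothesis against the character
    of [U] leaves [2^N] times [c U], since a coordinate where [T] and [U] differ contributes a
    factor 1 - 1. *)
Lemma sign_characters (c : {ffun 'I_N -> bool} -> F) :
    (forall e : {ffun 'I_N -> bool}, \sum_(T : {ffun 'I_N -> bool}) (\prod_a (-1) ^+ (e a && T a)) * c T = 0) ->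
  forall T, c T = 0.
Proof.
move=> c0 U; have : \sum_(e : {ffun 'I_N -> bool}) (\prod_a (-1) ^+ (e a && U a)) *
    (\sum_(T : {ffun 'I_N -> bool}) (\prod_a (-1) ^+ (e a && T a)) * c T) = 0.
  by rewrite big1 // => e _; rewrite c0 mulr0.
under eq_bigr => e _ do rewrite mulr_sumr.
rewrite exchange_big /=.
have E T : \sum_(e : {ffun 'I_N -> bool}) (\prod_a (-1) ^+ (e a && U a)) *
     ((\prod_a (-1) ^+ (e a && T a)) * c T) =
   (\prod_a \sum_(b : bool) (-1) ^+ (b && U a) * (-1) ^+ (b && T a)) * c T.
  rewrite bigA_distr_bigA mulr_suml; apply: eq_bigr => e _.
  by rewrite mulrA -big_split.
under eq_bigr => T _ do rewrite E.
rewrite (bigD1 U) //= [X in _ + X]big1 => [|T TU]; last first.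
  have /existsP[a aTU] : [exists a, T a != U a].
    apply: contraNT TU; rewrite negb_exists => /forallP TU.
    by apply/eqP/ffunP => a; apply/eqP; have := TU a; rewrite negbK.
  rewrite (bigD1 a) //= big_bool /=; move: aTU.
  by case: (T a); case: (U a) => //= _; rewrite !(expr0, expr1, mulr1, mul1r) addNr !mul0r.
rewrite addr0 => /eqP; rewrite mulf_eq0 => /orP[|/eqP//].
rewrite prodf_seq_eq0 => /hasP[a _ /=]; rewrite big_bool /=.
by case: (U a); rewrite !(expr0, expr1) ?mulrNN mulr1 -mulr2n pnatr_eq0.
Qed.

(** A sign change of [z] multiplies the term of [T] by a value of the character of [T], so
    [sign_characters] separates the terms. *)
Lemma parity_part_vanish f (z : 'I_N -> F) :
    (forall e : {ffun 'I_N -> bool}, f.@[fun a => (-1) ^+ e a * z a] = 0) ->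
  forall T, (\prod_a z a ^+ T a) * (parity_part T f).@[fun a => z a ^+ 2] = 0.
Proof.
move=> f0; apply: sign_characters => e; rewrite -[RHS](f0 e) [RHS]mmap_parity.
apply: eq_bigr => T _; rewrite mulrA -big_split; congr (_ * _).
  by apply: eq_bigr => a _ /=; rewrite exprMn -exprM mulnb.
by apply: meval_eq => a; rewrite exprMn sqrr_sign mul1r.
Qed.

End Parity.

(** * Degree along stars of polynomials vanishing on the unsquared variety *)

Section StarSize.
Variables (F : numClosedFieldType) (n d : nat) (f : {mpoly F[nedges n]}).
Hypothesis f_van : forall (u : 'I_d.+1 -> 'I_n -> F) (z : 'I_(nedges n) -> F),
  (forall a, z a ^+ 2 = \sum_k cutform (u k) (u k) a) -> f.@[z] = 0.

(** [parity_part_vanish] leaves a factor made of coordinates that may be 0. So [u] is moved along a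
    line on which no coordinate vanishes identically, the factor is cancelled among polynomials in
    [t], and [t = 0] is taken. *)
Lemma vanish_parity_part T : vanish d.+1 (parity_part T f).
Proof.
(* Only the first coordinate function moves, its speed at a vertex being the number of that vertex.
   As these are distinct, each [Q a] has a non-zero coefficient of degree 2. *)
move=> u; pose u0 (k : 'I_d.+1) (i : 'I_n) : F := (k == ord0)%:R * (i : nat)%:R.
pose ut t k i := u k i + t * u0 k i.
pose Q a : {poly F} := (\sum_k cutform (u k) (u k) a)%:P +
  (2 * \sum_k cutform (u k) (u0 k) a)%:P * 'X + (\sum_k cutform (u0 k) (u0 k) a)%:P * 'X^2.
have Qt a t : (Q a).[t] = \sum_k cutform (ut t k) (ut t k) a.
  rewrite /Q !hornerE /= mulr_sumr !mulr_suml -!big_split; apply: eq_bigr => k _ /=.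
  by rewrite /cutform /ut; ring.
have Q0 a : Q a != 0.
  apply/eqP => /(congr1 (fun p : {poly F} => p`_2)).
  rewrite !coefD coefC coefCM coefX mulr0 coefCM coefXn eqxx mulr1 coef0 !add0r.
  rewrite big_ord_recl big1 => [|k _].
    rewrite addr0 /cutform /u0 eqxx !mul1r => /eqP.
    by rewrite mulf_eq0 orbb subr_eq0 eqr_nat => /eqP/val_inj/eqP; rewrite (negbTE (src_neq_tgt a)).
  by rewrite /cutform /u0 !mul0r subrr mul0r.
have : (\prod_a Q a ^+ T a) * mmap polyC Q (parity_part T f) = 0.
  apply: poly_eq0_nat => t; rewrite hornerM horner_mmap horner_prod.
  pose z a := sqrtC (Q a).[t%:R].
  have zE a : z a ^+ 2 = (Q a).[t%:R] by rewrite sqrtCK.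
  (* The factor enters squared because [Q a] is polynomial in [t] while its root [z a] is not. *)
  rewrite (eq_bigr (fun a => z a ^+ T a * z a ^+ T a)) => [|a _]; last first.
    by rewrite horner_exp -zE exprAC expr2.
  rewrite big_split -mulrA /= (meval_eq (v2 := fun a => z a ^+ 2)) => [|a]; last by rewrite zE.
  rewrite parity_part_vanish ?mulr0 // => e.
  by apply: (f_van (u := ut t%:R)) => a; rewrite exprMn sqrr_sign mul1r zE Qt.
move/eqP; rewrite mulf_eq0 => /orP[|/eqP /(congr1 (fun p : {poly F} => p.[0]))].
  by rewrite prodf_seq_eq0 => /hasP[a _ /=]; rewrite expf_eq0 (negbTE (Q0 a)) andbF.
rewrite horner_mmap horner0 => e; rewrite -[RHS]e; apply: meval_eq => a.
by rewrite Qt; apply: eq_bigr => k _; rewrite /cutform /ut !mul0r !addr0.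
Qed.

Hypothesis f_deg : degle d.+2.*2 f.

(** The part of [T] has twice its degree plus the size of [T] at most [2(d+2)]. For non-empty [T]
    this leaves degree [d+1], so the part is 0 by [vanish_degle]; the even part has degree at most
    [d+2], as [vanish_mdir2] requires. *)
Lemma size_star_line i (z s : 'I_(nedges n) -> F) :
    (forall a, s a ^+ 2 = (i \in ends a)%:R) ->
  (size (mmap polyC (fun a => (z a)%:P + (s a)%:P * 'X)%R f) <= 3)%N.
Proof.
move=> sE; rewrite mmap_parity (bigD1 [ffun=> false]) //= [X in _ + X]big1 => [|T T0].
  rewrite addr0 big1 => [|a _]; last by rewrite ffunE.
  rewrite mul1r; apply: (size_star_curve _ z sE) => v.
  apply: vanish_mdir2 (vanish_parity_part _) _.
  by apply: degle_parity_part f_deg _ => c; lia.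
rewrite (vanish_degle (vanish_parity_part T)) ?rmorph0 ?mulr0 //.
apply: degle_parity_part f_deg _ => c dc.
have : (0 < \sum_a T a)%N.
  rewrite lt0n sum_nat_eq0; apply: contra T0 => /forallP T0.
  by apply/eqP/ffunP => a; rewrite ffunE; apply/eqP; have := T0 a; rewrite /= eqb0 => /negbTE ->.
lia.
Qed.

End StarSize.

(** * Minors of the Gram matrix *)

Section Degle.
Variables (F : numClosedFieldType) (N : nat).
Implicit Types g h : {mpoly F[N]}.

Lemma degleD k g h : degle k g -> degle k h -> degle k (g + h).
Proof. by move=> gk hk m km; rewrite mcoeffD gk ?hk ?addr0. Qed.

Lemma degleN k g : degle k g -> degle k (- g).
Proof. by move=> gk m km; rewrite mcoeffN gk ?oppr0. Qed.

Lemma degle_sum (I : Type) (r : seq I) (P : pred I) k (E : I -> {mpoly F[N]}) :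
  (forall x, P x -> degle k (E x)) -> degle k (\sum_(x <- r | P x) E x).
Proof.
move=> Ek; apply: big_ind => //; first by move=> m _; rewrite mcoeff0.
exact: degleD.
Qed.

Lemma degleM k l g h : degle k g -> degle l h -> degle (k + l) (g * h).
Proof.
move=> gk hl m km; rewrite mcoeffM big1 // => -[m1 m2] /= /eqP mE.
have [k1|k1] := ltnP k (mdeg m1); first by rewrite gk ?mul0r.
rewrite hl ?mulr0 //; have := congr1 mdeg mE; rewrite mdegD; lia.
Qed.

Lemma degle_prod (I : finType) k (E : I -> {mpoly F[N]}) :
  (forall x, degle k (E x)) -> degle (k * #|I|) (\prod_x E x).
Proof.
move=> Ek; rewrite mulnC -sum_nat_const.
apply: (big_rec2 (fun p d => degle d p)) => [m m0|x d p _ dp].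
  by rewrite mcoeff1 -mdeg_eq0 gtn_eqF.
exact: degleM.
Qed.

Lemma degle_sign k (b : bool) g : degle k g -> degle k ((-1) ^+ b * g).
Proof. by rewrite mulr_sign; case: b => // gk; apply: degleN. Qed.

End Degle.

Section Minors.
Variable n : nat.

(* Twice the Gram matrix of the vectors p_i - p_o. *)
Definition gram (S : comNzRingType) (l : 'I_(nedges n) -> S) (o i j : 'I_n) : S :=
  crd l o i ^+ 2 + crd l o j ^+ 2 - crd l i j ^+ 2.

(** Over any commutative ring, so that one expression serves at points, along lines and as a
    polynomial in the coordinates. *)
Definition minor (S : comNzRingType) (l : 'I_(nedges n) -> S) o k (r c : 'I_k -> 'I_n) : S :=
  \det (\matrix_(x < k, y < k) gram l o (r x) (c y)).

Lemma crd_rmorph (S T : comNzRingType) (h : {rmorphism S -> T}) l (i j : 'I_n) :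
  h (crd l i j) = crd (fun a => h (l a)) i j.
Proof. by rewrite /crd rmorph_sum. Qed.

Lemma minor_rmorph (S T : comNzRingType) (h : {rmorphism S -> T}) l o k (r c : 'I_k -> 'I_n) :
  h (minor l o r c) = minor (fun a => h (l a)) o r c.
Proof.
rewrite /minor -det_map_mx; congr (\det _); apply/matrixP => x y.
by rewrite !mxE /gram rmorphB rmorphD !rmorphXn !crd_rmorph.
Qed.

Lemma eq_minor (S : comNzRingType) (l l' : 'I_(nedges n) -> S) o k (r c : 'I_k -> 'I_n) :
  l =1 l' -> minor l o r c = minor l' o r c.
Proof.
move=> ll; have e i j : crd l i j = crd l' i j by apply: eq_bigr => a _.
by rewrite /minor; congr (\det _); apply/matrixP => x y; rewrite !mxE /gram !e.
Qed.

Variable F : numClosedFieldType.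

Lemma minor_degle (l : 'I_(nedges n) -> {mpoly F[nedges n]}) o k (r c : 'I_k -> 'I_n) :
  (forall a, degle 1 (l a)) -> degle k.*2 (minor l o r c).
Proof.
move=> l1; have cl i j : degle 2 (crd l i j ^+ 2).
  by apply: (degleM (k := 1) (l := 1)); apply: degle_sum.
apply: degle_sum => s _; apply: degle_sign.
rewrite -mul2n -[X in (2 * X)%N]card_ord; apply: degle_prod => x; rewrite mxE.
by apply: degleD; [apply: degleD | apply: degleN].
Qed.

Lemma crd_measurement d (u : 'I_d -> 'I_n -> F) l (i j : 'I_n) :
    (forall a, l a ^+ 2 = \sum_k cutform (u k) (u k) a) ->
  crd l i j ^+ 2 = \sum_k (u k i - u k j) ^+ 2.
Proof.
move=> lE; have [->|ij] := eqVneq i j.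
  by rewrite crdii expr0n big1 // => k _; rewrite subrr expr0n.
have [a ea] := edge_ex ij; rewrite (crd_ends _ ea) lE; apply: eq_bigr => k _.
by rewrite /cutform; case: (ends_src_tgt ea) => -[-> ->]; ring.
Qed.

(** The matrix consists of doubled scalar products of vectors in dimension [d], so it factors
    through rank [d] and is singular. *)
Lemma minor_measurement d (u : 'I_d -> 'I_n -> F) l o (r c : 'I_d.+1 -> 'I_n) :
    (forall a, l a ^+ 2 = \sum_k cutform (u k) (u k) a) ->
  minor l o r c = 0.
Proof.
move=> lE; apply/eqP; apply: contraTT isT => mn0.
pose P := \matrix_(x < d.+1, k < d) (2 * (u k (r x) - u k o)).
pose Q := \matrix_(k < d, y < d.+1) (u k (c y) - u k o).
have : (\matrix_(x < d.+1, y < d.+1) gram l o (r x) (c y) = P *m Q).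
  apply/matrixP => x y; rewrite !mxE /gram !(crd_measurement _ _ lE).
  rewrite -big_split -sumrB; apply: eq_bigr => k _ /=; rewrite !mxE; ring.
move=> e; have : \rank (P *m Q) = d.+1.
  by apply/mxrank_unit; rewrite -e unitmxE unitfE.
have := leq_trans (mxrankM_maxl P Q) (rank_leq_col P).
by move=> /[swap] ->; rewrite ltnn.
Qed.

(** The minor composed with [A] still vanishes on the variety, which [A] preserves; [size_star_line]
    is applied to it at the point [invmx A *m z]. *)
Lemma size_minor_star d (A : 'M[F]_(nedges n)) i o (r c : 'I_d.+2 -> 'I_n)
    (z : 'I_(nedges n) -> F) (s : 'cV_(nedges n)) :
    A \in unitmx ->
    (forall (l : 'cV_(nedges n)) (u : 'I_d.+1 -> 'I_n -> F),
      (forall a, l a 0 ^+ 2 = \sum_k cutform (u k) (u k) a) ->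
      exists u' : 'I_d.+1 -> 'I_n -> F,
        forall a, (A *m l) a 0 ^+ 2 = \sum_k cutform (u' k) (u' k) a) ->
    (forall a, s a 0 ^+ 2 = (i \in ends a)%:R) ->
  (size (minor (fun a => (z a)%:P + ((A *m s) a 0)%:P * 'X)%R o r c) <= 3)%N.
Proof.
move=> Au AL sE.
pose f := minor (fun a => \sum_b A a b *: 'X_b : {mpoly F[nedges n]}) o r c.
have f_deg : degle d.+2.*2 f.
  apply: minor_degle => a; apply: degle_sum => b _ m m1.
  by rewrite mcoeffZ mcoeffX; case: eqVneq => [mb|]; rewrite ?mulr0 //; rewrite -mb mdeg1 in m1.
have fE (S : comNzRingType) (h : {rmorphism F -> S}) (t : 'I_(nedges n) -> S) :
    mmap h t f = minor (fun a => \sum_b h (A a b) * t b) o r c.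
  rewrite /f minor_rmorph; apply: eq_minor => a; rewrite raddf_sum.
  by apply: eq_bigr => b _ /=; rewrite mmapZ mmapX mmap1U.
have f_van (u : 'I_d.+1 -> 'I_n -> F) (t : 'I_(nedges n) -> F) :
    (forall a, t a ^+ 2 = \sum_k cutform (u k) (u k) a) -> f.@[t] = 0.
  move=> tE; have [|u' u'E] := AL (\col_a t a) u; first by move=> a; rewrite mxE.
  rewrite /meval fE; apply: (minor_measurement (u := u')) => a.
  by rewrite -u'E mxE; congr (_ ^+ 2); apply: eq_bigr => b _; rewrite mxE.
have := size_star_line f_van f_deg (fun b => (invmx A *m (\col_a z a)) b 0) sE.
rewrite fE (@eq_minor _ _ (fun a => (z a)%:P + ((A *m s) a 0)%:P * 'X)) // => a.
under eq_bigr => b _ do rewrite mulrDr mulrA -!polyCM.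
rewrite big_split -mulr_suml -!raddf_sum /=; congr (_%:P + _%:P * _).
  have /matrixP/(_ a 0) := mulKVmx Au (\col_a z a).
  by rewrite !mxE => <-.
by rewrite mxE.
Qed.

End Minors.

(** * Expansion of a determinant in its last two rows *)

Lemma ord2_neq0 (y : 'I_2) : y <> 0 -> y = 1.
Proof. by case: y => [[|[|]]] // y2 y0; [case: y0|]; apply: val_inj. Qed.

Section PairExtraction.
Variables (S : comNzRingType) (k : nat) (M : 'M[S]_(k, k + 2)).

Definition stack2 (r1 r2 : 'rV[S]_(k + 2)) : 'M[S]_(k + 2) :=
  \matrix_(i, j) match split i with
    | inl i' => M i' j
    | inr b => if b == 0 then r1 0 j else r2 0 j
    end.

Lemma det_stack2l a b r1 r1' r2 :
  \det (stack2 (a *: r1 + b *: r1') r2) =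
  a * \det (stack2 r1 r2) + b * \det (stack2 r1' r2).
Proof.
apply: (determinant_multilinear (i0 := rshift k 0)).
- by apply/rowP => j; rewrite !mxE -[rshift k 0]/(unsplit (inr 0)) unsplitK eqxx.
all: apply/matrixP => i j; rewrite !mxE; case: splitP => // y iy; case: eqP => // y0.
all: have /eqP[] := neq_lift (rshift k (0 : 'I_2)) i.
all: by apply: val_inj; apply: esym; apply: (etrans iy); rewrite y0.
Qed.

Lemma det_stack2r a b r1 r2 r2' :
  \det (stack2 r1 (a *: r2 + b *: r2')) =
  a * \det (stack2 r1 r2) + b * \det (stack2 r1 r2').
Proof.
apply: (determinant_multilinear (i0 := rshift k 1)).
- by apply/rowP => j; rewrite !mxE -[rshift k 1]/(unsplit (inr 1)) unsplitK /=.
all: apply/matrixP => i j; rewrite !mxE; case: splitP => // y iy; case: eqP => // y0.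
all: have y1 := ord2_neq0 y0.
all: have /eqP[] := neq_lift (rshift k (1 : 'I_2)) i.
all: by apply: val_inj; apply: esym; apply: (etrans iy); rewrite y1.
Qed.

End PairExtraction.

(** Each of the last two rows is [a] times a unit row plus a fixed row. In the multilinear
    expansion, [a ^+ 2] comes with both unit rows, that is, with a block triangular determinant
    equal to that of [B]. *)
Lemma det_pencil2 (S : comNzRingType) k (B : 'M[S]_k) (P : 'M_(k, 2)) (Q : 'M_(2, k))
    (E : 'M_2) :
  exists b1 b0, forall a,
    \det (block_mx B P Q (a%:M + E)) = \det B * a ^+ 2 + b1 * a + b0.
Proof.
pose D r1 r2 := \det (stack2 (row_mx B P) r1 r2).
pose e (b : 'I_2) : 'rV[S]_(k + 2) := row_mx 0 (delta_mx 0 b).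
pose q (b : 'I_2) : 'rV[S]_(k + 2) := row_mx (row b Q) (row b E).
exists (D (e 0) (q 1) + D (q 0) (e 1)), (D (q 0) (q 1)) => a.
have -> : \det B = D (e 0) (e 1).
  rewrite -[LHS]mulr1 -(det1 S 2) -(det_ublock B P); congr (\det _).
  apply/matrixP => i j; rewrite !mxE; case: splitP => y _; rewrite !mxE //.
  by case: eqP => [->|/ord2_neq0 ->]; case: (split j) => x; rewrite !mxE // eqxx eq_sym.
have -> : block_mx B P Q (a%:M + E) =
    stack2 (row_mx B P) (a *: e 0 + 1 *: q 0) (a *: e 1 + 1 *: q 1).
  apply/matrixP => i j; rewrite !mxE; case: splitP => y _; rewrite !mxE //.
  by case: eqP => [->|/ord2_neq0 ->]; case: (split j) => x;
    rewrite !mxE ?mulr0 ?add0r ?mul1r // eqxx eq_sym mulr_natr.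
rewrite det_stack2l !det_stack2r /D; ring.
Qed.

(** * Cubic terms of minors, and reduction to small minors *)

Section ThirdDifference.
Variable F : numClosedFieldType.
Implicit Types p q : F -> F.

(* A difference operator killing quadratic polynomials; on polynomials of degree
   at most 6 it is [-48] times the coefficient of degree 3. *)
Definition tdiff p : F :=
  13 * (p 1 - p (-1)) - 8 * (p 2 - p (-2)) + (p 3 - p (-3)).

Lemma tdiff_size (P : {poly F}) : (size P <= 3)%N -> tdiff (fun t => P.[t]) = 0.
Proof.
move=> P3; rewrite /tdiff !(horner_coef_wide _ P3) !big_ord_recl !big_ord0 /=; ring.
Qed.

Lemma eq_tdiff p q : p =1 q -> tdiff p = tdiff q.
Proof. by move=> pq; rewrite /tdiff !pq. Qed.

End ThirdDifference.

Section LowGrowth.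
Variables (F : numClosedFieldType) (n : nat) (x : 'I_(nedges n) -> F).
Implicit Types (z : 'I_(nedges n) -> F) (i j o u v : 'I_n) (V : seq 'I_n).

(** Growth is tested by [tdiff] and not by a degree: this is linear in the values, hence survives
    the extraction below. [V] collects the vertices used up by it. *)
Definition low_growth k V := forall z o (r c : 'I_k -> 'I_n),
  o \notin V -> (forall y, r y \notin V) -> (forall y, c y \notin V) ->
  tdiff (fun t => minor (fun a => z a + t * x a) o r c) = 0.

Definition extend2 k (r : 'I_k -> 'I_n) u v (y : 'I_(k + 2)) : 'I_n :=
  match split y with inl y' => r y' | inr b => if b == 0 then u else v end.

Lemma extend2_notin k (r : 'I_k -> 'I_n) u v V y :
  u \notin V -> v \notin V -> (forall y, r y \notin V) -> extend2 r u v y \notin V.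
Proof. by move=> uV vV rV; rewrite /extend2; case: (split y) => // b; case: eqP. Qed.

(* Rows end in [u, v] and columns in [v, u], so that both entries involving the
   edge uv lie on the diagonal. *)
Lemma minor_extend2 z o u v k (r c : 'I_k -> 'I_n) w :
    u != v -> o != u -> o != v ->
    (forall y, r y \notin [:: u; v]) -> (forall y, c y \notin [:: u; v]) ->
  exists b1 b0 a, forall lam,
    minor (fun e => if ends e == [set u; v]%SET then lam + w else z e) o
      (extend2 r u v) (extend2 c v u) =
    minor z o r c * (a - (lam + w) ^+ 2) ^+ 2 + b1 * (a - (lam + w) ^+ 2) + b0.
Proof.
move=> uv ou ov rV cV; pose Z lam e := if ends e == [set u; v]%SET then lam + w else z e.
have crdZ lam i j : [set i; j]%SET != [set u; v]%SET -> crd (Z lam) i j = crd z i j.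
  by move=> ij; apply: eq_bigr => a /eqP ea; rewrite /Z ea (negbTE ij).
have crdZuv lam : crd (Z lam) u v = lam + w.
  by have [a ea] := edge_ex uv; rewrite (crd_ends _ ea) /Z ea eqxx.
have nin i j : i \notin [:: u; v] -> [set i; j]%SET != [set u; v]%SET.
  by rewrite !inE => iuv; apply: contra iuv => /eqP/finset.setP/(_ i); rewrite !inE eqxx.
have oV : o \notin [:: u; v] by rewrite !inE negb_or ou.
have crdo lam i : crd (Z lam) o i = crd z o i by rewrite crdZ ?nin.
have crdr lam y i : crd (Z lam) (r y) i = crd z (r y) i by rewrite crdZ ?nin.
have crdc lam y i : crd (Z lam) i (c y) = crd z i (c y).
  by rewrite crdC crdZ ?nin // crdC.
pose B := \matrix_(x0 < k, y < k) gram z o (r x0) (c y).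
pose P := \matrix_(x0 < k, y < 2) gram z o (r x0) (if y == 0 then v else u).
pose Q := \matrix_(x0 < 2, y < k) gram z o (if x0 == 0 then u else v) (c y).
pose E := \matrix_(x0 < 2, y < 2) if x0 == y then 0 else
  gram z o (if x0 == 0 then u else v) (if x0 == 0 then u else v).
have [b1 [b0 bE]] := det_pencil2 B P Q E.
exists b1, b0, (crd z o u ^+ 2 + crd z o v ^+ 2) => lam.
rewrite -bE -[LHS]/(minor (Z lam) o (extend2 r u v) (extend2 c v u)); congr (\det _); apply/matrixP => i j; rewrite !mxE /extend2.
case: (split i) => y; rewrite mxE; case: (split j) => y'; rewrite !mxE /gram !crdo ?crdr ?crdc //.
have y01 (b : 'I_2) : b = 0 \/ b = 1 by case: (eqVneq b 0) => [|/eqP/ord2_neq0]; [left|right].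
case: (y01 y) => ->; case: (y01 y') => ->; rewrite ?eqxx /= ?mulr1n ?mulr0n ?addr0 ?add0r.
- by rewrite crdZuv.
- by rewrite !crdii.
- by rewrite !crdii.
- by rewrite [crd _ v u]crdC crdZuv [crd z o v ^+ 2 + _]addrC.
Qed.

(** The coordinate of [z] at [uv] becomes a free [lam]. By [minor_extend2] the larger minor is a
    quartic in [lam] with leading coefficient the smaller one, so its fourth difference is 24 times
    the smaller minor. *)
Lemma low_growth_extract k V u v : low_growth (k + 2) V ->
  u \notin V -> v \notin V -> u != v -> low_growth k [:: u, v & V].
Proof.
move=> lg uV vV uv z o r c oV rV cV.
have ninV i : i \notin [:: u, v & V] -> (i \notin V) * (i \notin [:: u; v]).
  by rewrite !inE !negb_or => /and3P[-> -> ->].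
have [ou ov] : o != u /\ o != v by move: oV; rewrite !inE !negb_or => /and3P[].
pose Z lam e := if ends e == [set u; v]%SET then lam else z e.
pose G lam t := minor (fun a => Z lam a + t * x a) o (extend2 r u v) (extend2 c v u).
have G0 lam : tdiff (G lam) = 0.
  by apply: lg => [|y|y]; [rewrite ninV | |]; rewrite ?extend2_notin // => y'; rewrite ninV.
have GE t : 24 * minor (fun a => z a + t * x a) o r c =
    G 2 t - 4 * G 1 t + 6 * G 0 t - 4 * G (-1) t + G (-2) t.
  have [||b1 [b0 [a mE]]] := @minor_extend2 (fun a => z a + t * x a) o u v k r c
    (t * crd x u v) uv ou ov.
  - by move=> y; rewrite ninV.
  - by move=> y; rewrite ninV.
  have e lam : G lam t = minor (fun e => if ends e == [set u; v]%SET then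
      lam + t * crd x u v else z e + t * x e) o (extend2 r u v) (extend2 c v u).
    apply: eq_minor => b; rewrite /Z; case: eqP => // eb.
    by rewrite (crd_ends _ eb).
  rewrite !e !mE; ring.
have ME t : minor (fun a => z a + t * x a) o r c =
    (G 2 t - 4 * G 1 t + 6 * G 0 t - 4 * G (-1) t + G (-2) t) / 24.
  by rewrite -GE mulrC mulKf // pnatr_eq0.
have -> : tdiff (fun t => minor (fun a => z a + t * x a) o r c) = (tdiff (G 2) -
    4 * tdiff (G 1) + 6 * tdiff (G 0) - 4 * tdiff (G (-1)) + tdiff (G (-2))) / 24.
  rewrite /tdiff !ME; ring.
by rewrite !G0 !mulr0 !subr0 !addr0 mul0r.
Qed.

Lemma low_growth_extracts k h V : uniq V -> size V = h.*2 ->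
  low_growth (k + h.*2) [::] -> low_growth k V.
Proof.
elim: h k V => [|h IH] k V; first by rewrite addn0 => _ /size0nil ->.
case: V => [|u [|v V]] //= /and3P[]; rewrite inE negb_or => /andP[uv uV] vV Vu [sV] lg.
apply: low_growth_extract => //; apply: IH => //.
by rewrite -addnA addSn add1n -doubleS.
Qed.

End LowGrowth.

(** * Images of stars *)

Lemma det_mx22 (S : comNzRingType) (M : 'M[S]_2) : \det M = M 0 0 * M 1 1 - M 0 1 * M 1 0.
Proof.
rewrite (expand_det_row _ 0) !big_ord_recl big_ord0 /cofactor !det_mx11 !mxE /=.
have -> : lift 0 0 = 1 :> 'I_2 by apply: val_inj.
have -> : lift 1 0 = 0 :> 'I_2 by apply: val_inj.
rewrite expr0 expr1; ring.
Qed.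

Lemma det_mx33 (S : comNzRingType) (M : 'M[S]_3) : \det M =
  M 0 0 * (M 1 1 * M 2 2 - M 1 2 * M 2 1) - M 0 1 * (M 1 0 * M 2 2 - M 1 2 * M 2 0)
  + M 0 2 * (M 1 0 * M 2 1 - M 1 1 * M 2 0).
Proof.
rewrite (expand_det_row _ 0) !big_ord_recl big_ord0 /cofactor !det_mx22 !mxE /=.
have -> : lift 0 0 = 1 :> 'I_3 by apply: val_inj.
have -> : lift 0 1 = 2 :> 'I_3 by apply: val_inj.
have -> : lift 1 0 = 0 :> 'I_3 by apply: val_inj.
have -> : lift 1 1 = 2 :> 'I_3 by apply: val_inj.
have -> : lift ord0 (lift ord0 ord0) = 2 :> 'I_3 by apply: val_inj.
have -> : lift 2 0 = 0 :> 'I_3 by apply: val_inj.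
have -> : lift 2 1 = 1 :> 'I_3 by apply: val_inj.
rewrite -[ord0]/(0 : 'I_3) -[(0 + 0)%N]/0%N -[(0 + bump 0 0)%N]/1%N -[(0 + _)%N]/2%N.
rewrite expr0 expr1 sqrrN expr1n; ring.
Qed.

Section Stars.
Variables (F : numClosedFieldType) (n : nat) (x : 'I_(nedges n) -> F).
Implicit Types (z : 'I_(nedges n) -> F) (i j o p q k l : 'I_n) (V : seq 'I_n).

Lemma crd_line z t i j : crd (fun a => z a + t * x a) i j = crd z i j + t * crd x i j.
Proof. by rewrite /crd big_split mulr_sumr. Qed.

Definition basis_edge p q (a : 'I_(nedges n)) : F := (ends a == [set p; q]%SET)%:R.

Lemma crd_basis_edge p q i j : i != j ->
  crd (basis_edge p q) i j = ((i == p) && (j == q) || (i == q) && (j == p))%:R.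
Proof.
move=> ij; have [a ea] := edge_ex ij; rewrite (crd_ends _ ea) /basis_edge ea.
congr (nat_of_bool _)%:R; apply/eqP/idP => [e|].
  have ip : i \in [set p; q]%SET by rewrite -e set21.
  have jp : j \in [set p; q]%SET by rewrite -e set22.
  move: ip jp ij; rewrite !inE => /orP[] /eqP -> /orP[] /eqP ->; rewrite ?eqxx ?orbT //.
by case/orP=> /andP[/eqP-> /eqP->] //; rewrite finset.setUC.
Qed.

Lemma minor22 (l : 'I_(nedges n) -> F) o (r c : 'I_2 -> 'I_n) : minor l o r c =
  gram l o (r 0) (c 0) * gram l o (r 1) (c 1) - gram l o (r 0) (c 1) * gram l o (r 1) (c 0).
Proof. by rewrite /minor det_mx22 !mxE. Qed.

(** At [z] the basis vector of [oi], the minor on [i, j] has [t^3]-coefficient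
    [4 x_oi (x_oj^2 + x_ij^2 - x_oi^2)]; the 192 is 4 times the 48 of [tdiff]. *)
Lemma low_growth2_triangle V o i j : low_growth x 2 V ->
    o \notin V -> i \notin V -> j \notin V -> uniq [:: o; i; j] ->
  crd x o i != 0 -> crd x o j ^+ 2 + crd x i j ^+ 2 = crd x o i ^+ 2.
Proof.
move=> lg oV iV jV; rewrite /= !inE !negb_or !andbT => /andP[/andP[oi oj] ij] oi0.
pose r (y : 'I_2) := if y == 0 then i else j.
have rV y : r y \notin V by rewrite /r; case: ifP.
have := lg (basis_edge o i) o r r oV rV rV.
have io : i != o by rewrite eq_sym.
have ji : j != i by rewrite eq_sym.
have jo : j != o by rewrite eq_sym.
rewrite /tdiff !minor22 /r /= /gram !crd_line !crdii !crd_basis_edge //.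
rewrite !eqxx ?(negbTE oi, negbTE oj, negbTE ij, negbTE io, negbTE ji, negbTE jo) /= => e.
apply: (mulfI oi0); apply/esym/subr0_eq; apply: (@mulfI _ 192); first by rewrite pnatr_eq0.
rewrite mulr0 -e (crdC x j i); ring.
Qed.
(** With rows [i, j] and columns [i, k], the [t^3]-coefficient is [2 x_oi (T_j + T_k - 2 x_jk^2)],
    where [T_j] and [T_k] are the defects of the triangle relations for [oij] and [oik], zero by the
    previous lemma. *)
Lemma low_growth2_disjoint V o i j k : low_growth x 2 V ->
    o \notin V -> i \notin V -> j \notin V -> k \notin V -> uniq [:: o; i; j; k] ->
  crd x o i * crd x j k = 0.
Proof.
move=> lg oV iV jV kV u4.
have T p q r : crd x p q != 0 -> p \in [:: o; i; j; k] -> q \in [:: o; i; j; k] ->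
    r \in [:: o; i; j; k] -> uniq [:: p; q; r] -> crd x p r ^+ 2 + crd x q r ^+ 2 = crd x p q ^+ 2.
  have sub y : y \in [:: o; i; j; k] -> y \notin V.
    by rewrite !inE => /or4P[] /eqP ->.
  by move=> pq0 /sub pV /sub qV /sub rV u3; apply: low_growth2_triangle lg _ _ _ u3 pq0.
have [->|oi0] := eqVneq (crd x o i) 0; first by rewrite mul0r.
have Tj : crd x o j ^+ 2 + crd x i j ^+ 2 = crd x o i ^+ 2.
  apply: T => //; rewrite ?inE ?eqxx ?orbT //.
  by move: u4; rewrite /= !inE !negb_or; do !case: eqP.
have Tk : crd x o k ^+ 2 + crd x i k ^+ 2 = crd x o i ^+ 2.
  apply: T => //; rewrite ?inE ?eqxx ?orbT //.
  by move: u4; rewrite /= !inE !negb_or; do !case: eqP.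
move: u4; rewrite /= !inE !negb_or !andbT => /and3P[/and3P[oi oj ok] /andP[ij ik] jk].
pose r (y : 'I_2) := if y == 0 then i else j.
pose c (y : 'I_2) := if y == 0 then i else k.
have rV y : r y \notin V by rewrite /r; case: ifP.
have cV y : c y \notin V by rewrite /c; case: ifP.
have := lg (basis_edge o i) o r c oV rV cV.
have io : i != o by rewrite eq_sym.
have ji : j != i by rewrite eq_sym.
have jo : j != o by rewrite eq_sym.
have ki : k != i by rewrite eq_sym.
have ko : k != o by rewrite eq_sym.
have kj : k != j by rewrite eq_sym.
rewrite /tdiff !minor22 /r /c /= /gram !crd_line !crdii !crd_basis_edge //.
rewrite !eqxx ?(negbTE oi, negbTE oj, negbTE ok, negbTE ij, negbTE ik, negbTE jk).
rewrite ?(negbTE io, negbTE ji, negbTE jo, negbTE ki, negbTE ko, negbTE kj) /= (crdC x j i) => e.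
apply/eqP; rewrite mulf_eq0 (negbTE oi0) /= -sqrf_eq0; apply/eqP.
apply: (mulfI oi0); apply: (@mulfI _ 192); first by rewrite pnatr_eq0.
have T0 : crd x o j ^+ 2 + crd x i j ^+ 2 - crd x o i ^+ 2 +
    (crd x o k ^+ 2 + crd x i k ^+ 2 - crd x o i ^+ 2) = 0.
  by rewrite Tj Tk !subrr addr0.
rewrite !mulr0 -[RHS]addr0 -[X in _ = X + _]e -[X in _ = _ + X](mulr0 (96 * crd x o i)).
rewrite -[X in _ = _ + _ * X]T0; ring.
Qed.
Lemma minor33 (l : 'I_(nedges n) -> F) o (r : 'I_3 -> 'I_n) : minor l o r r =
  gram l o (r 0) (r 0) * (gram l o (r 1) (r 1) * gram l o (r 2) (r 2) -
    gram l o (r 1) (r 2) * gram l o (r 2) (r 1)) -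
  gram l o (r 0) (r 1) * (gram l o (r 1) (r 0) * gram l o (r 2) (r 2) -
    gram l o (r 1) (r 2) * gram l o (r 2) (r 0)) +
  gram l o (r 0) (r 2) * (gram l o (r 1) (r 0) * gram l o (r 2) (r 1) -
    gram l o (r 1) (r 1) * gram l o (r 2) (r 0)).
Proof. by rewrite /minor det_mx33 !mxE. Qed.

(** For [z] the basis vector of [oi] the [t^3]-coefficient is [-8 x_oi x_jk^2]. Once [x_jk = 0],
    adding the basis vector of [jk] to [z] gives [4 x_oi (T_j + T_k)], so only the sum of the two
    triangle defects is controlled. *)
Lemma low_growth3_disjoint V o i j k : low_growth x 3 V ->
    o \notin V -> i \notin V -> j \notin V -> k \notin V -> uniq [:: o; i; j; k] ->
  crd x o i * crd x j k = 0 /\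
  (crd x o i != 0 -> crd x o j ^+ 2 + crd x i j ^+ 2 +
    (crd x o k ^+ 2 + crd x i k ^+ 2) = crd x o i ^+ 2 *+ 2).
Proof.
move=> lg oV iV jV kV.
rewrite /= !inE !negb_or !andbT => /and3P[/and3P[oi oj ok] /andP[ij ik] jk].
have io : i != o by rewrite eq_sym.
have ji : j != i by rewrite eq_sym.
have jo : j != o by rewrite eq_sym.
have ki : k != i by rewrite eq_sym.
have ko : k != o by rewrite eq_sym.
have kj : k != j by rewrite eq_sym.
pose r (y : 'I_3) := if y == 0 then i else if y == 1 then j else k.
have rV y : r y \notin V by rewrite /r; case: ifP => // _; case: ifP.
have D : crd x o i * crd x j k = 0.
  have := lg (basis_edge o i) o r r oV rV rV.
  rewrite /tdiff !minor33 /r /= /gram !crd_line !crdii !crd_basis_edge //.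
  rewrite !eqxx ?(negbTE oi, negbTE oj, negbTE ok, negbTE ij, negbTE ik, negbTE jk).
  rewrite ?(negbTE io, negbTE ji, negbTE jo, negbTE ki, negbTE ko, negbTE kj) /=.
  rewrite (crdC x j i) (crdC x k i) (crdC x k j) => e.
  have : crd x o i * crd x j k ^+ 2 = 0.
    apply: (@mulfI _ 384); first by rewrite pnatr_eq0.
    rewrite mulr0 -[RHS]e; ring.
  by move/eqP; rewrite mulf_eq0 sqrf_eq0 -mulf_eq0 => /eqP.
split=> // oi0; have jk0 : crd x j k = 0.
  by move/eqP: D; rewrite mulf_eq0 (negbTE oi0) => /eqP.
have := lg (fun a => basis_edge o i a + 1 * basis_edge j k a) o r r oV rV rV.
have cD p q : crd (fun a => basis_edge o i a + 1 * basis_edge j k a) p q =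
    crd (basis_edge o i) p q + crd (basis_edge j k) p q.
  by rewrite /crd -big_split; apply: eq_bigr => a _; rewrite /= mul1r.
rewrite /tdiff !minor33 /r /= /gram !crd_line !crdii !cD !crd_basis_edge //.
rewrite !eqxx ?(negbTE oi, negbTE oj, negbTE ok, negbTE ij, negbTE ik, negbTE jk).
rewrite ?(negbTE io, negbTE ji, negbTE jo, negbTE ki, negbTE ko, negbTE kj) /=.
rewrite (crdC x j i) (crdC x k i) (crdC x k j) jk0 => e.
apply: (mulfI oi0); apply/esym/subr0_eq.
apply: (@mulfI _ 192); first by rewrite pnatr_eq0.
rewrite mulr0 -[RHS]e; ring.
Qed.
End Stars.

Lemma uniq_avoiding n (s : seq 'I_n) m : (m + size s <= n)%N ->
  exists V : seq 'I_n, [/\ uniq V, size V = m & {in s, forall v, v \notin V}].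
Proof.
move=> ms; exists (take m [seq v <- enum 'I_n | v \notin s]); split.
- by rewrite take_uniq // filter_uniq // enum_uniq.
- apply: size_takel; rewrite size_filter -[X in (_ <= X)%N]addn0.
  have := count_predC (mem s) (enum 'I_n); rewrite size_enum_ord.
  have : (count (mem s) (enum 'I_n) <= size s)%N.
    rewrite -size_filter; apply: uniq_leq_size; first by rewrite filter_uniq // enum_uniq.
    by move=> v; rewrite mem_filter => /andP[].
  rewrite (eq_count (a1 := predC (mem s)) (a2 := fun v => v \notin s)) //; lia.
- by move=> v vs; apply: contraL vs => /mem_take; rewrite mem_filter => /andP[].
Qed.

Lemma ex_notin n (s : seq 'I_n) : (size s < n)%N -> exists v, v \notin s.
Proof.
move=> sn; have [V [_ V1 sV]] := @uniq_avoiding n s 1 sn.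
case: V V1 sV => // v V _ sV.
by exists v; apply/negP => /sV; rewrite inE eqxx.
Qed.

(** * Vectors of low growth are multiples of stars *)

Section StarShape.
Variables (F : numClosedFieldType) (n : nat) (x : 'I_(nedges n) -> F).

(** Extracting pairs of vertices brings minors of size [d.+2] down to size 2 for even [d] and size 3
    for odd [d]; the bound on [n] leaves the four given vertices untouched. *)
Lemma star_relations d o i j k : (d + 4 <= n)%N -> low_growth x d.+2 [::] ->
    uniq [:: o; i; j; k] ->
  crd x o i * crd x j k = 0 /\
  (crd x o i != 0 -> crd x o j ^+ 2 + crd x i j ^+ 2 = crd x o i ^+ 2).
Proof.
move=> dn lg u4; have [od|od] := boolP (odd d); last first.
  have dE : d.+2 = (2 + d./2.*2)%N by rewrite -{1}(odd_double_half d) (negbTE od).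
  have [|V [Vu sV V4]] := @uniq_avoiding n [:: o; i; j; k] d./2.*2.
    by rewrite /= -(leq_add2l 0) (leq_trans _ dn) // -{2}(odd_double_half d); lia.
  have lg2 : low_growth x 2 V by apply: low_growth_extracts Vu sV _; rewrite -dE.
  have [oV iV jV kV] : [/\ o \notin V, i \notin V, j \notin V & k \notin V].
    by split; apply: V4; rewrite !inE eqxx ?orbT.
  split; first exact: low_growth2_disjoint lg2 _ _ _ _ u4.
  apply: low_growth2_triangle lg2 oV iV jV _.
  by move: u4; rewrite /= !inE !negb_or => /and4P[/and3P[-> -> _] /andP[-> _] _ _].
have dE : d.+2 = (3 + d./2.*2)%N by rewrite -{1}(odd_double_half d) od.
have lg3 p q r s : uniq [:: p; q; r; s] -> crd x p q * crd x r s = 0 /\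
  (crd x p q != 0 -> crd x p r ^+ 2 + crd x q r ^+ 2 +
    (crd x p s ^+ 2 + crd x q s ^+ 2) = crd x p q ^+ 2 *+ 2).
  move=> pqrs; have [|V [Vu sV V4]] := @uniq_avoiding n [:: p; q; r; s] d./2.*2.
    by rewrite /= (leq_trans _ dn) // -{2}(odd_double_half d); lia.
  have lg3 : low_growth x 3 V by apply: low_growth_extracts Vu sV _; rewrite -dE.
  by apply: low_growth3_disjoint lg3 _ _ _ _ pqrs; apply: V4; rewrite !inE eqxx ?orbT.
split=> [|oi0]; first by have [] := lg3 _ _ _ _ u4.
(* For odd [d] there is a fifth vertex [l]. The defects of [j, k, l] have pairwise sums 0, so each
   is 0. *)
have [|l] := @ex_notin n [:: o; i; j; k].
  by rewrite /= (leq_trans _ dn) // -(odd_double_half d) od; lia.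
move: u4; rewrite /= !inE !negb_or !andbT => /and3P[/and3P[oi oj ok] /andP[ij ik] jk].
move=> /and4P[lo li lj lk].
have /lg3[_ /(_ oi0) jkE] : uniq [:: o; i; j; k].
  by rewrite /= !inE !negb_or oi oj ok ij ik jk.
have /lg3[_ /(_ oi0) jlE] : uniq [:: o; i; j; l].
  by rewrite /= !inE !negb_or oi oj ij 1!eq_sym lo 1!eq_sym li 1!eq_sym lj.
have /lg3[_ /(_ oi0) klE] : uniq [:: o; i; k; l].
  by rewrite /= !inE !negb_or oi ok ik 1!eq_sym lo 1!eq_sym li 1!eq_sym lk.
apply: (@mulfI _ 2); first by rewrite pnatr_eq0.
rewrite [RHS]mulr_natl -[RHS]addr0 -{1}jkE -(subrr (crd x o i ^+ 2 *+ 2)) -{1}jlE -klE; ring.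
Qed.

Lemma star_shape d : (d + 4 <= n)%N -> low_growth x d.+2 [::] ->
  (exists a, x a != 0) ->
  exists2 e, e != 0 & exists k, forall a, x a ^+ 2 = e * (k \in ends a)%:R.
Proof.
move=> dn lg [a0 xa0]; have rel := star_relations dn lg.
have n4 : (4 <= n)%N := leq_trans (leq_addl _ _) dn.
pose o0 := src a0; pose i0 := tgt a0.
have oi0 : o0 != i0 := src_neq_tgt a0.
have xoi0 : crd x o0 i0 != 0 by rewrite crd_src_tgt.
(* The triangle relation on a non-zero edge and a third vertex yields a second non-zero edge; the
   common end of the two is the center [o]. *)
have [o [i [l [oi ol il xoi xol]]]] : exists o i l,
    [/\ o != i, o != l, i != l, crd x o i != 0 & crd x o l != 0].
  have [|j] := @ex_notin n [:: o0; i0]; first by apply: leq_trans n4.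
  have [|k] := @ex_notin n [:: o0; i0; j]; first by apply: leq_trans n4.
  rewrite !inE !negb_or => /and3P[ko ki kj] /andP[jo ji].
  have [|_ /(_ xoi0) T] := rel o0 i0 j k.
    by rewrite /= !inE !negb_or oi0 1!eq_sym jo 1!eq_sym ko 1!eq_sym ji 1!eq_sym ki 1!eq_sym kj.
  have [oj|oj] := eqVneq (crd x o0 j) 0; last first.
    by exists o0, i0, j; split=> //; rewrite 1?eq_sym.
  exists i0, o0, j; split; try by rewrite eq_sym.
    by rewrite crdC.
  by apply: contra xoi0 => /eqP ij; rewrite -sqrf_eq0 -T oj ij !expr0n addr0.
have zero_off u v w : uniq [:: o; u; v; w] -> crd x o u != 0 -> crd x v w = 0.
  by move=> /rel[/eqP + _] ou; rewrite mulf_eq0 (negbTE ou) => /eqP.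
(* For [j] other than [i, l], the edge [ij] is disjoint from [ol], hence zero, and the triangle
   [oij] gives equal squares. *)
have ois j : j != o -> crd x o j ^+ 2 = crd x o i ^+ 2.
  move=> jo; have [->//|ji] := eqVneq j i.
  have lj0 : j != l -> crd x o j ^+ 2 = crd x o i ^+ 2.
    move=> jl; have [|_ /(_ xoi) <-] := rel o i j l.
      by rewrite /= !inE !negb_or oi ol il 1!eq_sym jo 1!eq_sym ji jl.
    rewrite (zero_off l i j) ?expr0n ?addr0 //.
    by rewrite /= !inE !negb_or oi ol 1!eq_sym jo 1!eq_sym il 1!eq_sym jl 1!eq_sym ji.
  have [jl|] := eqVneq j l; last exact: lj0.
  (* For [j = l] a fourth vertex [k] takes over the role of [l], once [ok] is known to be
     non-zero. *)
  have [|k] := @ex_notin n [:: o; i; l]; first by apply: leq_trans n4.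
  rewrite !inE !negb_or => /and3P[ko ki kl]; rewrite jl.
  have xok : crd x o k != 0.
    have [|_ /(_ xoi) T] := rel o i k l.
      by rewrite /= !inE !negb_or oi ol il kl 1!eq_sym ko 1!eq_sym ki.
    apply: contra xoi => /eqP ok0; rewrite -sqrf_eq0 -T ok0.
    rewrite (zero_off l i k) ?expr0n ?addr0 //.
    by rewrite /= !inE !negb_or oi ol 1!eq_sym ko 1!eq_sym il 1!eq_sym kl 1!eq_sym ki.
  have [|_ /(_ xoi) <-] := rel o i l k.
    by rewrite /= !inE !negb_or oi ol il 1!eq_sym ko 1!eq_sym ki 1!eq_sym kl.
  rewrite (zero_off k i l) ?expr0n ?addr0 //.
  by rewrite /= !inE !negb_or oi ol il 1!eq_sym ko ki kl.
exists (crd x o i ^+ 2); first by rewrite sqrf_eq0.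
exists o => a; rewrite mem_ends.
have [oa|oa] := eqVneq o (src a).
  by rewrite mulr1 -(ois (tgt a)) ?oa ?crd_src_tgt // eq_sym src_neq_tgt.
have [oa'|oa'] := eqVneq o (tgt a).
  by rewrite mulr1 -(ois (src a)) ?oa' 1?crdC ?crd_src_tgt // src_neq_tgt.
rewrite /= mulr0; have [|k] := @ex_notin n [:: o; src a; tgt a]; first by apply: leq_trans n4.
rewrite !inE !negb_or => /and3P[ko ks kt].
rewrite -crd_src_tgt (zero_off k) ?expr0n //.
  by rewrite /= !inE !negb_or oa oa' ks kt src_neq_tgt 1!eq_sym ko.
by rewrite -sqrf_eq0 (ois k ko) sqrf_eq0.
Qed.

End StarShape.

(** * Centers *)

Section Automorphisms.
Variables (R : realType) (n : nat).
Local Notation C := (R[i]).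
Local Notation N := (nedges n).
Implicit Types (A : 'M[C]_N) (s v w : 'cV[C]_N) (i j k : 'I_n) (a b : 'I_N).

Lemma unsquaredP d (l : 'cV[C]_N) : unsquared_variety d l <->
  exists u : 'I_d -> 'I_n -> C, forall a, l a 0 ^+ 2 = \sum_k cutform (u k) (u k) a.
Proof.
split=> [[p _ pl]|[u uE]].
  exists (fun (k : 'I_d) i => p i 0 k) => a; have /colP/(_ a) := pl; rewrite !mxE => <-.
  by apply: eq_bigr => k _; rewrite /cutform -expr2.
exists (fun i => \row_(k < d) u k i) => //; apply/colP => a; rewrite !mxE uE.
by apply: eq_bigr => k _; rewrite !mxE /cutform -expr2.
Qed.

Lemma automorphism_mem d A l : linear_automorphism d A ->
  unsquared_variety d (A *m l) <-> unsquared_variety d l.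
Proof.
move=> [Au AL]; split=> [|lL]; last by rewrite -AL; exists l.
by rewrite -{1}AL => -[l' l'L /(can_inj (mulKmx Au)) <-].
Qed.

Lemma automorphism_inv d A : linear_automorphism d A -> linear_automorphism d (invmx A).
Proof.
move=> hA; have [Au _] := hA; split; first by rewrite unitmx_inv.
apply/seteqP; split=> [_ [l lL <-]|l lL] /=.
  by apply/(automorphism_mem _ hA); rewrite mulKVmx.
exists (A *m l); last exact: mulKmx.
exact/automorphism_mem.
Qed.

Definition starlike k (e : C) v := forall a, v a 0 ^+ 2 = e * (k \in ends a)%:R.

Lemma starlike_neq0 k e v a : e != 0 -> starlike k e v -> (v a 0 != 0) = (k \in ends a).
Proof. by move=> e0 ve; rewrite -sqrf_eq0 ve mulf_eq0 (negbTE e0) pnatr_eq0 eqb0 negbK. Qed.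

Lemma starlike_eq0 k e v a : starlike k e v -> k \notin ends a -> v a 0 = 0.
Proof.
by move=> ve /negbTE ka; apply/eqP; rewrite -sqrf_eq0 ve ka mulr0.
Qed.

Lemma ex_edge_at i : (1 < n)%N -> exists a, i \in ends a.
Proof.
move=> n1; have [|j] := @ex_notin n [:: i]; first by [].
by rewrite inE eq_sym => /edge_ex[a ea]; exists a; rewrite ea set21.
Qed.

(** [size_minor_star] is the low growth of [A *m s] for minors of size [d.+2], so [star_shape]
    applies; invertibility of [A] makes the image non-zero. *)
Lemma automorphism_star d A i s : (d + 4 <= n)%N -> linear_automorphism d.+1 A ->
  starlike i 1 s -> exists2 e, e != 0 & exists k, starlike k e (A *m s).
Proof.
move=> dn hA si; apply: (star_shape (x := fun a => (A *m s) a 0) dn).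
  move=> z o r c _ _ _; rewrite -[RHS](tdiff_size (P :=
    minor (fun a => (z a)%:P + ((A *m s) a 0)%:P * 'X)%R o r c)).
    apply: eq_tdiff => t; rewrite -[RHS]/(horner_eval t _) minor_rmorph.
    by apply: eq_minor => a; rewrite /= /horner_eval hornerD hornerM !hornerC hornerX mulrC.
  apply: (size_minor_star (i := i)) => [|l u lu|a]; last by rewrite si mul1r.
    by case: hA.
  by apply/unsquaredP/(automorphism_mem _ hA)/unsquaredP; exists u.
have [Au _] := hA; have [a ia] := ex_edge_at i (leq_trans (leq_trans (isT : (1 < 4)%N) (leq_addl _ _)) dn).
apply/existsP; apply: contraT; rewrite negb_exists => /forallP As0.
have : s = 0.
  rewrite -[s](mulKmx Au) (_ : A *m s = 0) ?mulmx0 //; apply/colP => b; rewrite [RHS]mxE.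
  by have := As0 b; rewrite negbK => /eqP.
move/colP/(_ a) => sa; have := starlike_neq0 a (oner_neq0 _) si.
by rewrite sa mxE eqxx ia.
Qed.

(** [s - flip b s] is a multiple of the basis vector of [b], which brings basis vectors within reach
    of statements on stars. *)
Definition flip b s : 'cV[C]_N := \col_a ((-1) ^+ (a == b) * s a 0).

Lemma flip_starlike b s k e : starlike k e s -> starlike k e (flip b s).
Proof. by move=> se a; rewrite mxE exprMn sqrr_sign mul1r. Qed.

Lemma edge_at_both k k' a b : k != k' -> k \in ends a -> k' \in ends a ->
  ends b = [set k; k']%SET -> a = b.
Proof.
move=> kk ka ka' eb; apply: ends_inj; rewrite eb; apply/finset.setP => v.
move: ka ka' kk; rewrite !mem_ends !inE => /orP[] /eqP -> /orP[] /eqP ->;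
  rewrite ?eqxx // => _; by rewrite orbC.
Qed.

Lemma mulmx_eq0_unit A v : A \in unitmx -> A *m v = 0 -> v = 0.
Proof. by move=> Au Av; rewrite -[v](mulKmx Au) Av mulmx0. Qed.

(* If the two images had different centers, their sum would also lie in the
   one-dimensional variety, hence so would [s + flip b s]; but a triangle
   through [i] containing [b] has squared measurements 0, 0 and 4 there. *)
Lemma flip_center_dim1 A s i b k k' e e' : (4 <= n)%N -> linear_automorphism 1 A ->
    starlike i 1 s -> i \in ends b -> starlike k e (A *m s) ->
  starlike k' e' (A *m flip b s) -> k = k'.
Proof.
move=> n4 hA si ib vk vk'; apply/eqP; apply: contraT => kk.
have [a0 ea0] := edge_ex kk; set v := A *m s in vk; set v' := A *m flip b s in vk'.
have : unsquared_variety 1 (A *m (s + flip b s)).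
  (* On the line, [k] is placed at [v a0 0], [k'] at [- v' a0 0] and all other vertices at 0; the
     only edge where both stars contribute is [a0]. *)
  apply/unsquaredP; exists (fun _ j => ind C k j * v a0 0 - ind C k' j * v' a0 0) => a.
  rewrite big_ord_recl big_ord0 addr0 mulmxDr -/v -/v' mxE.
  have -> : cutform (fun j => ind C k j * v a0 0 - ind C k' j * v' a0 0)
      (fun j => ind C k j * v a0 0 - ind C k' j * v' a0 0) a =
      v a0 0 ^+ 2 * cutform (ind C k) (ind C k) a + v' a0 0 ^+ 2 * cutform (ind C k') (ind C k') a
      - 2 * (v a0 0 * v' a0 0) * cutform (ind C k) (ind C k') a by rewrite /cutform; ring.
  have cE : cutform (ind C k) (ind C k') a = - (a0 == a)%:R.
    rewrite -cutform_ind; case: (ends_src_tgt ea0) => -[-> ->] //.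
    by rewrite /cutform mulrC.
  rewrite !cutform_ind_ends cE vk vk' ea0 set21 set22 !mulr1.
  have vvE : v a 0 * v' a 0 = v a0 0 * v' a0 0 * (a0 == a)%:R.
    have [<-|aa0] := eqVneq a0 a; first by rewrite mulr1.
    have [ka|/(starlike_eq0 vk) ->] := boolP (k \in ends a); last by rewrite mul0r mulr0.
    have [ka'|/(starlike_eq0 vk') ->] := boolP (k' \in ends a); last by rewrite !mulr0.
    by rewrite (edge_at_both kk ka ka' ea0) eqxx in aa0.
  transitivity (v a 0 ^+ 2 + v' a 0 ^+ 2 + 2 * (v a 0 * v' a 0)); first by ring.
  rewrite vk vk' vvE; ring.
move/(automorphism_mem _ hA)/unsquaredP => [u uE].
have [j bj] : exists j, ends b = [set i; j]%SET.
  move: ib; rewrite mem_ends => /orP[] /eqP ->; first by exists (tgt b).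
  by exists (src b); rewrite finset.setUC.
have [|j'] := @ex_notin n [:: i; j]; first exact: leq_trans n4.
rewrite !inE negb_or => /andP[j'i j'j].
have [b1 eb1] := edge_ex j'i; have [b2 eb2] := edge_ex j'j.
have ij : i != j.
  by apply: contraTneq (src_neq_tgt b) => ij; move: (ends_src_tgt bj); rewrite ij => -[] [-> ->]; rewrite eqxx.
have D p q : crd (fun a => (s + flip b s) a 0) p q ^+ 2 = (u ord0 p - u ord0 q) ^+ 2.
  by rewrite (crd_measurement (u := u)) // big_ord_recl big_ord0 addr0.
have := D i j; rewrite (crd_ends _ bj) !mxE eqxx expr1 mulN1r subrr expr0n /= => /esym/eqP.
rewrite sqrf_eq0 subr_eq0 => /eqP uij.
have nb1 : (b1 == b) = false.
  apply/eqP => bb; have : j' \in ends b by rewrite -bb eb1 set21.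
  by rewrite bj !inE (negbTE j'i) (negbTE j'j).
have nb2 : (b2 == b) = false.
  apply/eqP => bb; have : j' \in ends b by rewrite -bb eb2 set21.
  by rewrite bj !inE (negbTE j'i) (negbTE j'j).
have := D j' i; rewrite uij -(D j') (crd_ends _ eb1) (crd_ends _ eb2) !mxE nb1 nb2 expr0 !mul1r.
have -> : s b2 0 = 0.
  by apply: starlike_eq0 si _; rewrite eb2 !inE (negbTE ij) orbF eq_sym.
rewrite -!mulr2n mul0rn exprMn_n si eb1 set22 !mulr1 expr0n => /eqP.
by rewrite pnatr_eq0.
Qed.

(* For a second edge [b'] the images of [s], [flip b s], [flip b' s] and
   [flip b (flip b' s)] satisfy v + v3 = v1 + v2; looking at the edges joining
   a center to a vertex outside all four centers, each center occurs twice, so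
   one of the two vectors below is mapped into the line of the edge kk'. *)
Lemma flip_pair d A s i b b' k k' e e' : (d + 4 <= n)%N -> (5 <= n)%N ->
    linear_automorphism d.+1 A -> starlike i 1 s -> b != b' ->
    e != 0 -> starlike k e (A *m s) ->
    e' != 0 -> starlike k' e' (A *m flip b s) -> k != k' ->
  exists2 w, w = s - flip b' s \/ w = s + flip b (flip b' s) &
    forall a, (A *m w) a 0 != 0 -> ends a = [set k; k']%SET.
Proof.
move=> dn n5 hA si bb e0 vk e'0 vk' kk.
have s1 := flip_starlike b si; have s2 := flip_starlike b' si.
have [e2 e20 [k2 vk2]] := automorphism_star dn hA s2.
have [e3 e30 [k3 vk3]] := automorphism_star dn hA (flip_starlike b s2).
set v := A *m s in vk; set v1 := A *m flip b s in vk'.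
set v2 := A *m flip b' s in vk2; set v3 := A *m flip b (flip b' s) in vk3.
have fE : s + flip b (flip b' s) = flip b s + flip b' s.
  apply/colP => a; rewrite !mxE; have [->|_] := eqVneq a b; last by rewrite !mul1r.
  by rewrite (negbTE bb) expr0 expr1 !mul1r addrC.
have vE : v + v3 = v1 + v2 by rewrite -!mulmxDr fE.
have [|m] := @ex_notin n [:: k; k'; k2; k3]; first exact: leq_trans n5.
rewrite !inE !negb_or => /and4P[mk mk' mk2 mk3].
have mem_m c l a : ends a = [set m; c]%SET -> m != l -> (l \in ends a) = (l == c).
  by move=> -> ml; rewrite !inE eq_sym (negbTE ml).
have [a ea] := edge_ex mk; have [a' ea'] := edge_ex mk'.
have addE (x y : 'cV[C]_N) c : (x + y) c 0 = x c 0 + y c 0 by rewrite mxE.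
have va : v a 0 != 0 by rewrite (starlike_neq0 _ e0 vk) ea set22.
have v1a' : v1 a' 0 != 0 by rewrite (starlike_neq0 _ e'0 vk') ea' set22.
have v1a : v1 a 0 = 0.
  by apply: starlike_eq0 vk' _; rewrite (mem_m _ _ _ ea) // eq_sym.
have va' : v a' 0 = 0.
  by apply: starlike_eq0 vk _; rewrite (mem_m _ _ _ ea').
have k23 : (k2 == k) || (k3 == k).
  apply: contraT; rewrite negb_or => /andP[k2k k3k].
  have /colP/(_ a) := vE; rewrite !addE v1a add0r.
  rewrite (starlike_eq0 vk2) ?(mem_m _ _ _ ea) // (starlike_eq0 vk3) ?(mem_m _ _ _ ea) //.
  by rewrite addr0 => va0; rewrite va0 eqxx in va.
have k23' : (k2 == k') || (k3 == k').
  apply: contraT; rewrite negb_or => /andP[k2k k3k].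
  have /colP/(_ a') := vE; rewrite !addE va' add0r.
  rewrite (starlike_eq0 vk2) ?(mem_m _ _ _ ea') // (starlike_eq0 vk3) ?(mem_m _ _ _ ea') //.
  by rewrite addr0 => va0; rewrite -va0 eqxx in v1a'.
have [b0 eb0] := edge_ex kk.
have both w w' : w = w' -> (forall a, k \notin ends a -> w a 0 = 0) ->
    (forall a, k' \notin ends a -> w' a 0 = 0) ->
    forall a, w a 0 != 0 -> ends a = [set k; k']%SET.
  move=> <- wk wk' c wc; rewrite -eb0; congr ends.
  apply: (edge_at_both kk _ _ eb0); apply: contraR wc => kc; [rewrite wk|rewrite wk'] => //.
have sub0 u u' l f f' : starlike l f u -> starlike l f' u' ->
    (forall a, l \notin ends a -> (u - u') a 0 = 0) /\
    (forall a, l \notin ends a -> (u + u') a 0 = 0).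
  by move=> ul ul'; split=> c lc; rewrite !mxE (starlike_eq0 ul) // (starlike_eq0 ul') ?subr0 ?addr0.
(* If [k2 = k] then [k3 = k'], and [v - v2 = v1 - v3] is supported both at [k] and at [k'].
   Otherwise the two centers are exchanged and [v + v3 = v1 + v2] has this property. *)
have [k2k|k2k] := eqVneq k2 k.
  have k3k' : k3 = k'.
    by move: k23'; rewrite k2k (negbTE kk) => /eqP.
  exists (s - flip b' s); first by left.
  rewrite mulmxBr -/v -/v2; apply: (both _ (v1 - v3)).
  - by apply/eqP; rewrite subr_eq -addrA [_ + v2]addrC addrA -vE addrK.
  - by rewrite k2k in vk2; have [] := sub0 _ _ _ _ _ vk vk2.
  - by rewrite k3k' in vk3; have [] := sub0 _ _ _ _ _ vk' vk3.
have k3k : k3 = k by move: k23; rewrite (negbTE k2k) => /eqP.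
have k2k' : k2 = k'.
  by move: k23'; rewrite k3k (negbTE kk) orbF => /eqP.
exists (s + flip b (flip b' s)); first by right.
rewrite mulmxDr -/v -/v3; apply: (both _ _ vE).
- by rewrite k3k in vk3; have [] := sub0 _ _ _ _ _ vk vk3.
- by rewrite k2k' in vk2; have [] := sub0 _ _ _ _ _ vk' vk2.
Qed.

(** An invertible matrix cannot send two independent vectors into one coordinate line; the
    coordinate [c] witnesses the independence. *)
Lemma image_in_line A (u w : 'cV[C]_N) a0 c : A \in unitmx -> u != 0 -> u c 0 = 0 -> w c 0 != 0 ->
    (forall a, (A *m u) a 0 != 0 -> a = a0) -> (forall a, (A *m w) a 0 != 0 -> a = a0) ->
  False.
Proof.
move=> Au u0 uc wc ul wl; set x := (A *m u) a0 0; set y := (A *m w) a0 0.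
have : y *: u - x *: w = 0.
  apply: (mulmx_eq0_unit Au); rewrite mulmxBr -!scalemxAr; apply/colP => a; rewrite [RHS]mxE.
  have -> : (y *: (A *m u) - x *: (A *m w)) a 0 = y * (A *m u) a 0 - x * (A *m w) a 0.
    by move: (A *m u) (A *m w) => u' w'; rewrite !mxE.
  have [->|aa0] := eqVneq a a0; first by rewrite -/x -/y mulrC subrr.
  have [/ul aE|] := boolP ((A *m u) a 0 != 0); first by rewrite aE eqxx in aa0.
  have [/wl aE|] := boolP ((A *m w) a 0 != 0); first by rewrite aE eqxx in aa0.
  by rewrite !negbK => /eqP-> /eqP->; rewrite !mulr0 subrr.
move=> /colP/(_ c); rewrite !mxE uc mulr0 sub0r => /eqP.
rewrite oppr_eq0 mulf_eq0 (negbTE wc) orbF => /eqP x0.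
move/negP: u0; apply; apply/eqP; apply: (mulmx_eq0_unit Au); apply/colP => a; rewrite [RHS]mxE.
have [/ul ->|] := boolP ((A *m u) a 0 != 0); first exact: x0.
by rewrite negbK => /eqP.
Qed.

(** In dimension at least 2 there are three further edges at [i]. If the centers differed,
    [flip_pair] for [b1] and for [b2] would give two independent vectors sent into the line of the
    edge [kk']. *)
Lemma flip_center A d s i b k k' e e' : (d + 4 <= n)%N -> linear_automorphism d.+1 A ->
    starlike i 1 s -> i \in ends b ->
    e != 0 -> starlike k e (A *m s) ->
    e' != 0 -> starlike k' e' (A *m flip b s) -> k = k'.
Proof.
move=> dn hA si ib e0 vk e'0 vk'; case: d => [|d] in dn hA *.
  exact: flip_center_dim1 dn hA si ib vk vk'.
apply/eqP; apply: contraT => kk.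
have n5 : (5 <= n)%N by apply: leq_trans dn; rewrite addSn ltnS leq_addl.
have s0 a : i \in ends a -> s a 0 != 0 by rewrite (starlike_neq0 _ (oner_neq0 _) si).
have [a0 ea0] := edge_ex kk.
have [j bj] : exists j, ends b = [set i; j]%SET.
  move: ib; rewrite mem_ends => /orP[] /eqP ->; first by exists (tgt b).
  by exists (src b); rewrite finset.setUC.
have edge_at (t : seq 'I_n) : (size t < 3)%N ->
    exists j', [/\ j' \notin [:: i, j & t] & exists b', ends b' = [set i; j']%SET].
  move=> t3; have [|j' j't] := @ex_notin n [:: i, j & t]; first by rewrite /=; lia.
  exists j'; split=> //; apply: edge_ex; rewrite eq_sym.
  by move: j't; rewrite !inE negb_or => /andP[].
have [j1 [j1t [b1 eb1]]] := edge_at [::] isT.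
have [j2 [j2t [b2 eb2]]] := edge_at [:: j1] isT.
have [j3 [j3t [b3 eb3]]] := edge_at [:: j1; j2] isT.
have neq_edge c c' p q : ends c = [set i; p]%SET -> ends c' = [set i; q]%SET ->
    q \notin [:: i; p] -> (c == c') = false /\ (c' == c) = false.
  move=> ec ec' qip; suff cc : c != c' by rewrite (negbTE cc) eq_sym (negbTE cc).
  apply: contra qip => /eqP cc; have : q \in ends c by rewrite cc ec' set22.
  by rewrite ec !inE.
move: j1t j2t j3t; rewrite !inE !negb_or => /andP[j1i j1j] /and3P[j2i j2j j21].
move=> /and4P[j3i j3j j31 j32].
have [bb1 b1b] : (b == b1) = false /\ (b1 == b) = false.
  by apply: neq_edge bj eb1 _; rewrite !inE negb_or j1i.
have [bb2 b2b] : (b == b2) = false /\ (b2 == b) = false.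
  by apply: neq_edge bj eb2 _; rewrite !inE negb_or j2i.
have [bb3 b3b] : (b == b3) = false /\ (b3 == b) = false.
  by apply: neq_edge bj eb3 _; rewrite !inE negb_or j3i.
have [b12 b21] : (b1 == b2) = false /\ (b2 == b1) = false.
  by apply: neq_edge eb1 eb2 _; rewrite !inE negb_or j2i.
have [b13 b31] : (b1 == b3) = false /\ (b3 == b1) = false.
  by apply: neq_edge eb1 eb3 _; rewrite !inE negb_or j3i.
have [b23 b32] : (b2 == b3) = false /\ (b3 == b2) = false.
  by apply: neq_edge eb2 eb3 _; rewrite !inE negb_or j3i.
have sb1 : s b1 0 != 0 by rewrite s0 ?eb1 ?set21.
have sb2 : s b2 0 != 0 by rewrite s0 ?eb2 ?set21.
have sb3 : s b3 0 != 0 by rewrite s0 ?eb3 ?set21.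
have [|w1 w1E w1l] := flip_pair dn n5 hA si (b' := b1) _ e0 vk e'0 vk' kk; first by rewrite bb1.
have [|w2 w2E w2l] := flip_pair dn n5 hA si (b' := b2) _ e0 vk e'0 vk' kk; first by rewrite bb2.
have line w : (forall a, (A *m w) a 0 != 0 -> ends a = [set k; k']%SET) ->
    forall a, (A *m w) a 0 != 0 -> a = a0.
  by move=> wl a /wl; rewrite -ea0 => /ends_inj.
have Au := hA.1.
have nz w c : w c 0 != 0 -> w != 0 by apply: contraNneq => ->; rewrite mxE.
have two x : x != 0 -> x + x != 0 :> C by rewrite -mulr2n mulrn_eq0.
have m2 x : (-1) ^+ true * x = - x :> C by rewrite expr1 mulN1r.
(* A vector of the first shape lives on its own edge; one of the second shape vanishes on [b] and
   its own edge and is [2 s] elsewhere. The edge [b3] is what separates the two shapes. *)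
case: w1E w2E w1l w2l => -> [] -> /line w1l /line w2l.
- case: (image_in_line (c := b2) Au _ _ _ w1l w2l).
  + by apply: (nz _ b1); rewrite !mxE eqxx m2 opprK two.
  + by rewrite !mxE b21 mul1r subrr.
  + by rewrite !mxE eqxx m2 opprK two.
- case: (image_in_line (c := b3) Au _ _ _ w1l w2l).
  + by apply: (nz _ b1); rewrite !mxE eqxx m2 opprK two.
  + by rewrite !mxE b31 mul1r subrr.
  + by rewrite !mxE b3b b32 !mul1r two.
- case: (image_in_line (c := b3) Au _ _ _ w2l w1l).
  + by apply: (nz _ b2); rewrite !mxE eqxx m2 opprK two.
  + by rewrite !mxE b32 mul1r subrr.
  + by rewrite !mxE b3b b31 !mul1r two.
- case: (image_in_line (c := b1) Au _ _ _ w1l w2l).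
  + by apply: (nz _ b2); rewrite !mxE b2b b21 !mul1r two.
  + by rewrite !mxE b1b eqxx mul1r m2 subrr.
  + by rewrite !mxE b1b b12 !mul1r two.
Qed.

End Automorphisms.

(** * The induced vertex permutation and the common scalar *)

Section VertexMap.
Variables (R : realType) (n d : nat) (A : 'M[R[i]]_(nedges n)).
Hypotheses (dn : (d + 4 <= n)%N) (hA : linear_automorphism d.+1 A).
Local Notation C := (R[i]).

Definition unit_star i : 'cV[C]_(nedges n) := \col_a (i \in ends a)%:R.

Lemma unit_star_starlike i : starlike i 1 (unit_star i).
Proof. by move=> a; rewrite mxE mul1r; case: (i \in _); rewrite ?expr1n ?expr0n. Qed.

(** Twice the basis vector of [b] is a difference of two stars at [i], and by [flip_center] both
    images are centered at [kap i]; so column [b] of [A] is supported there. *)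
Lemma vertex_map_ex : exists kap : 'I_n -> 'I_n,
  (forall i, exists2 e, e != 0 & starlike (kap i) e (A *m unit_star i)) /\
  forall i a b, i \in ends b -> A a b != 0 -> kap i \in ends a.
Proof.
have /fin_all_exists[kap kapP] : forall i, exists k, exists2 e : C, e != 0 &
    starlike k e (A *m unit_star i).
  move=> i; have [e e0 [k kE]] := automorphism_star dn hA (unit_star_starlike i).
  by exists k, e.
exists kap; split=> // i a b ib Aab; have [e e0 vE] := kapP i.
have si := unit_star_starlike i.
have [e' e'0 [k' vE']] := automorphism_star dn hA (flip_starlike b si).
have kE := flip_center dn hA si ib e0 vE e'0 vE'; rewrite -kE in vE'.
apply: contraR Aab => ka.
have : (A *m (unit_star i - flip b (unit_star i))) a 0 = 0.
  have subE (x y : 'cV[C]_(nedges n)) : (x - y) a 0 = x a 0 - y a 0 by rewrite !mxE.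
  by rewrite mulmxBr subE (starlike_eq0 vE) // (starlike_eq0 vE') // subr0.
have -> : unit_star i - flip b (unit_star i) = 2 *: delta_mx b 0.
  apply/colP => c; rewrite !mxE; have [->|cb] := eqVneq c b.
    by rewrite ib expr1 !mulr1 opprK.
  by rewrite mul1r subrr mulr0.
rewrite -scalemxAr -colE !mxE => /eqP.
by rewrite mulf_eq0 pnatr_eq0.
Qed.

End VertexMap.

Lemma automorphism_vertex_perm (R : realType) d n (A : 'M[R[i]]_(nedges n)) :
    (d + 4 <= n)%N -> linear_automorphism d.+1 A ->
  exists kap : 'S_n,
    (forall i, exists2 e, e != 0 & starlike (kap i) e (A *m unit_star R i)) /\
    forall a b, A a b != 0 -> ends a = [set kap x | x in ends b]%SET.
Proof.
move=> dn hA; have [kap [kapS kapP]] := vertex_map_ex dn hA.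
have [kap' [_ kapP']] := vertex_map_ex dn (automorphism_inv hA).
have kapK : cancel kap kap'.
  move=> i.
  (* Some term in the diagonal entry of [invmx A *m A] at [b] is non-zero; its two factors lead from
     [i] through [kap] and [kap'] back to an end of [b]. Two edges at [i] then determine that
     end. *)
  have at_i b : i \in ends b -> kap' (kap i) \in ends b.
    move=> ib; have /matrixP/(_ b b) := mulVmx hA.1; rewrite !mxE eqxx => sum1.
    have /existsP[a] : [exists a, invmx A b a * A a b != 0].
      apply: contraT; rewrite negb_exists => /forallP z.
      have : (1 : R[i]) != 0 := oner_neq0 _.
      by rewrite -[1]sum1 big1 ?eqxx // => a _; have := z a; rewrite negbK => /eqP.
    rewrite mulf_eq0 negb_or => /andP[Vba Aab].
    by apply: kapP' Vba; apply: kapP Aab.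
  have n4 : (4 <= n)%N := leq_trans (leq_addl _ _) dn.
  have [|j] := @ex_notin n [:: i]; first exact: leq_trans n4.
  have [|l] := @ex_notin n [:: i; j]; first exact: leq_trans n4.
  rewrite !inE negb_or eq_sym => /andP[il lj]; rewrite eq_sym => ij.
  have [b eb] := edge_ex ij; have [c ec] := edge_ex il.
  have := at_i b; have := at_i c; rewrite eb ec !inE !eqxx => /(_ isT) + /(_ isT).
  by move=> /orP[/eqP//|/eqP ->] /orP[/eqP//|/eqP lj']; rewrite lj' eqxx in lj.
exists (perm (can_inj kapK)); split=> [i|a b Aab].
  by have [e e0 eE] := kapS i; exists e => //; rewrite permE.
have ks : kap (src b) \in ends a by apply: kapP Aab; rewrite set21.
have kt : kap (tgt b) \in ends a by apply: kapP Aab; rewrite set22.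
have kk : kap (src b) != kap (tgt b) by rewrite (can_eq kapK) src_neq_tgt.
have [c ec] := edge_ex kk.
rewrite (edge_at_both kk ks kt ec) ec [in RHS]/ends imsetU !imset_set1.
by rewrite !permE.
Qed.

(** Each row of [A] has at most one non-zero entry, so the entry at [b] is read off from the image
    of the unit star at either end of [b]. Since any two vertices are joined by an edge, the squares
    agree for all vertices. *)
Lemma starlike_scalar (R : realType) n (A : 'M[R[i]]_(nedges n)) (kap : 'S_n) :
    (0 < n)%N ->
    (forall i, exists2 e, e != 0 & starlike (kap i) e (A *m unit_star R i)) ->
    (forall a b, A a b != 0 -> ends a = [set kap x | x in ends b]%SET) ->
  exists2 e, e != 0 &
    forall a b, ends a = [set kap x | x in ends b]%SET -> A a b ^+ 2 = e.
Proof.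
move=> n0 /fin_all_exists2[f f0 fE] AP.
have entry i a b : i \in ends b -> ends a = [set kap x | x in ends b]%SET ->
    A a b ^+ 2 = f i.
  move=> ib ab; have := fE i a; rewrite ab imset_f // mulr1 => <-.
  rewrite mxE (bigD1 b) //= mxE ib mulr1 big1 ?addr0 // => c cb.
  have [->|/AP ac] := eqVneq (A a c) 0; first by rewrite mul0r.
  by rewrite ac in ab; move/(imset_inj (@perm_inj _ kap))/ends_inj: ab cb => ->; rewrite eqxx.
exists (f (Ordinal n0)) => // a b ab.
have [b0|b0] := boolP (Ordinal n0 \in ends b); first exact: entry.
rewrite (entry (src b)) ?set21 //.
have ij : src b != Ordinal n0 by apply: contraNneq b0 => <-; rewrite set21.
have [c ec] := edge_ex ij.
have kij : kap (src b) != kap (Ordinal n0) by rewrite (inj_eq perm_inj).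
have [c' ec'] := edge_ex kij.
have E : ends c' = [set kap x | x in ends c]%SET.
  by rewrite ec' ec imsetU !imset_set1.
rewrite -(entry (src b) c' c _ E); last by rewrite ec set21.
by rewrite (entry (Ordinal n0) c' c _ E) // ec set22.
Qed.

Theorem theorem6p2 (R : realType) (d n : nat) (hd : (1 <= d)%N)
    (hn : (d + 3 <= n)%N) (A : 'M[R[i]]_(nedges n))
    (hA : linear_automorphism d A) :
  exists (c : R[i]) (S P : 'M[R[i]]_(nedges n)),
    [/\ sign_mx S, relabeling_mx P & A = c *: (S *m P)].
Proof.
case: d hd hn hA => // d _ hn hA.
have dn : (d + 4 <= n)%N by rewrite addnS -addSn.
have [kap [kapS AP]] := automorphism_vertex_perm dn hA.
have n0 : (0 < n)%N by apply: leq_trans dn; rewrite addnS.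
have [e e0 eE] := starlike_scalar n0 kapS AP.
(* Row [a] of [A] has its non-zero entry in column [f a], and [perm_mx] has its 1 in row [a] at the
   image of [a]; hence the relabeling is by the inverse of [kap]. *)
have /fin_all_exists[f fE] : forall a : 'I_(nedges n), exists b,
    ends b = [set (kap^-1)%g x | x in ends a]%SET.
  move=> a; have kk : (kap^-1)%g (src a) != (kap^-1)%g (tgt a).
    by rewrite (inj_eq perm_inj) src_neq_tgt.
  by have [b eb] := edge_ex kk; exists b; rewrite eb /ends imsetU !imset_set1.
have f_inj : injective f.
  move=> a b fab; apply: ends_inj; apply: (imset_inj (@perm_inj _ (kap^-1)%g)).
  by rewrite -!fE fab.
have kapf a b : ends a = [set kap x | x in ends b]%SET <-> f a = b.
  split=> [ab|<-]; last first.
    rewrite fE -imset_comp -[LHS]imset_id; apply: eq_imset => x /=.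
    by rewrite permKV.
  apply: ends_inj; rewrite fE ab -imset_comp -[RHS]imset_id; apply: eq_imset => x /=.
  by rewrite permK.
(* All non-zero entries have square [e], so dividing by a root of [e] leaves signs. *)
pose c := sqrtC e; have c0 : c != 0 by rewrite sqrtC_eq0.
exists c, (diag_mx (\row_a (A a (f a) / c))), (perm_mx (perm f_inj)); split.
- exists (\row_a (A a (f a) / c)) => // a; rewrite mxE.
  have : (A a (f a) / c) ^+ 2 == 1.
    by rewrite expr_div_n (eE _ _ ((kapf _ _).2 erefl)) sqrtCK divff.
  by rewrite sqrf_eq1 => /orP[] /eqP ->; [left|right].
- by exists (kap^-1)%g, (perm f_inj); split=> // a; rewrite permE fE.
apply/matrixP => a b; rewrite mxE mul_diag_mx !mxE permE.
have [<-|fab] := eqVneq (f a) b; first by rewrite mulr1 mulrC divfK.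
rewrite !mulr0; apply/eqP; apply: contraNT fab => /AP /kapf ->; exact: eqxx.
Qed.
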